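(* For every integer $d\ge 2$ and every prime power $q$, $$\nu(Y)=\operatorname{vol}(\Gamma\backslash\mathcal B_d)=\frac{d}{\left(\prod_{m=1}^{d}(q^m-1)\right)\left(\prod_{m=2}^{d-1}(q^m-1)\right)},$$ where the second product in the denominator is interpreted as $1$ when $d=2$.
   Context: Let $q$ be a prime power, $d\ge2$ an integer, $F=\mathbb F_q(\!(t^{-1})\!)$ with valuation ring $\mathcal O=\mathbb F_q[\![t^{-1}]\!]$. Put $G=\operatorname{PGL}_d(F)$, $K=\operatorname{PGL}_d(\mathcal O)$, $\Gamma=\operatorname{PGL}_d(\mathbb F_q[t])$. Haar measure on $G$ is normalized by $\operatorname{vol}(K)=1$. The vertices of the affine Bruhat--Tits building $\mathcal B_d$ of $G$ are identified with $G/K$. The vertex quotient is $Y=\Gamma\backslash G/K=\Gamma\backslash\mathcal B_d$ (a countable set), and $\nu$ is the measure on $Y$ induced from the Haar measure of $G$, i.e. the push-forward to $Y$ of the quotient measure on $\Gamma\backslash G$; equivalently each point $\Gamma gK$ has mass $1/|\Gamma\cap gKg^{-1}|$ (a finite group). The number $\nu(Y)=\operatorname{vol}(\Gamma\backslash\mathcal B_d)$ is the total mass (vertex-volume). *)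

(* Defs.v *)
From HB Require Import structures.
From mathcomp Require Import all_boot all_order all_algebra finmap zify.
From mathcomp Require Import all_classical all_reals all_analysis.
From mathcomp Require Import measurable_realfun.

Set Implicit Arguments.
Unset Strict Implicit.
Unset Printing Implicit Defensive.

Import Order.TTheory GRing.Theory Num.Theory.

Local Open Scope classical_set_scope.
Local Open Scope ring_scope.
Local Open Scope quotient_scope.

(* The field k((t^-1)) of formal Laurent series in t^-1: an element is its
   family of coefficients, f n being the coefficient of t^n (n : int). *)
Definition bounded_above (k : fieldType) (f : int -> k) :=
  exists N : int, forall n, N < n -> f n = 0.

Record laurent (k : fieldType) := Laurent {
  coefl :> int -> k;
  coeflP : bounded_above coefl }.

HB.instance Definition _ (k : fieldType) := gen_eqMixin (laurent k).
HB.instance Definition _ (k : fieldType) := gen_choiceMixin (laurent k).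

Section LaurentField.
Variable k : fieldType.
Implicit Types (f g h : laurent k) (u v w : int -> k) (N M L n : int).

Lemma laurentP f g : (forall n, f n = g n) -> f = g.
Proof.
case: f g => [f fP] [g gP] /= fg.
have E : f = g by exact: funext.
by case: _ / E gP => gP; congr Laurent; exact: Prop_irrelevance.
Qed.

Let bnd u N := forall n, N < n -> u n = 0.

Let bndW u N M : N <= M -> bnd u N -> bnd u M.
Proof. by move=> NM b n Mn; apply: b; apply: le_lt_trans Mn. Qed.

Let coeflB f : {N | bnd f N}.
Proof. exact/cid/coeflP. Qed.

Let bnd2 f g : {N | bnd f N /\ bnd g N}.
Proof.
have [N fN] := coeflB f; have [M gM] := coeflB g.
exists (Num.max N M); split.
  by apply: bndW fN; rewrite le_max lexx.
by apply: bndW gM; rewrite le_max lexx orbT.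
Qed.

Definition mulc u v n : k := \sum_(i \in [set: int]) u i * v (n - i).

Let mulc_seq u v n (r : seq int) : uniq r ->
  (forall i, i \notin r -> u i * v (n - i) = 0) ->
  mulc u v n = \sum_(i <- r) u i * v (n - i).
Proof.
move=> r_uniq r0; rewrite /mulc (fsbigE r)//; last by move=> i _; exact: r0.
by apply: eq_bigl => i; rewrite in_setT.
Qed.

Let P N (m : nat) u : {poly k} := \poly_(j < m) u (N - j%:Z).

Let mulc0 u v N M n : bnd u N -> bnd v M -> N + M < n -> mulc u v n = 0.
Proof.
move=> uN vM n_gt; apply: fsbig1 => i _.
have [iN|iN] := ltP N i; first by rewrite uN ?mul0r.
by rewrite (vM (n - i)) ?mulr0//; lia.
Qed.

Let mulcE u v N M (m s : nat) : bnd u N -> bnd v M -> (s < m)%N ->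
  mulc u v (N + M - s%:Z) = (P N m u * P M m v)`_s.
Proof.
move=> uN vM sm; pose r := [seq N - j%:Z | j <- iota 0 s.+1].
rewrite (@mulc_seq _ _ _ r); last 2 first.
- by rewrite map_inj_uniq ?iota_uniq// => i j /=; lia.
- move=> i ir; have [iN|iN] := ltP N i; first by rewrite uN ?mul0r.
  rewrite vM ?mulr0//; rewrite ltNge; apply/negP => le_i.
  move/negP: ir; apply; apply/mapP; exists (absz (N - i)); last lia.
  by rewrite mem_iota; lia.
rewrite big_map -[iota 0 s.+1]/(index_iota 0 s.+1) big_mkord coefM; apply: eq_bigr => j _.
have js := ltn_ord j.
by rewrite !coef_poly !ifT; [congr (_ * v _)| |]; lia.
Qed.

Fact mulc_bounded f g : bounded_above (mulc f g).
Proof.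
have [N fN] := coeflB f; have [M gM] := coeflB g.
by exists (N + M) => n; exact: mulc0.
Qed.

Fact zerol_bounded : bounded_above (fun=> 0 : k).
Proof. by exists 0. Qed.

Fact onel_bounded : bounded_above (fun n : int => (n == 0)%:R : k).
Proof. by exists 0 => n n0; rewrite gt_eqF. Qed.

Fact oppl_bounded f : bounded_above (fun n => - f n).
Proof. by have [N fN] := coeflB f; exists N => n Nn; rewrite fN ?oppr0. Qed.

Fact addl_bounded f g : bounded_above (fun n => f n + g n).
Proof.
have [N [fN gN]] := bnd2 f g; exists N => n Nn.
by rewrite fN// gN// addr0.
Qed.

Definition zerol := Laurent zerol_bounded.
Definition onel := Laurent onel_bounded.
Definition oppl f := Laurent (oppl_bounded f).
Definition addl f g := Laurent (addl_bounded f g).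
Definition mull f g := Laurent (mulc_bounded f g).

Fact addlA : associative addl.
Proof. by move=> f g h; apply: laurentP => n /=; rewrite addrA. Qed.
Fact addlC : commutative addl.
Proof. by move=> f g; apply: laurentP => n /=; rewrite addrC. Qed.
Fact add0l : left_id zerol addl.
Proof. by move=> f; apply: laurentP => n /=; rewrite add0r. Qed.
Fact addNl : left_inverse zerol oppl addl.
Proof. by move=> f; apply: laurentP => n /=; rewrite addNr. Qed.

Let coefM_low (p p' r : {poly k}) (m s : nat) : (s < m)%N ->
  (forall i, (i < m)%N -> p`_i = p'`_i) -> (p * r)`_s = (p' * r)`_s.
Proof.
move=> sm pp; rewrite !coefM; apply: eq_bigr => j _.
by rewrite pp//; apply: leq_trans sm; exact: ltn_ord.
Qed.

Let bnd_mulc u v N M : bnd u N -> bnd v M -> bnd (mulc u v) (N + M).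
Proof. by move=> uN vM n; exact: mulc0. Qed.

Let P_mulc u v N M (m i : nat) : bnd u N -> bnd v M -> (i < m)%N ->
  (P (N + M) m (mulc u v))`_i = (P N m u * P M m v)`_i.
Proof. by move=> uN vM im; rewrite coef_poly im (@mulcE _ _ N M m). Qed.

Let low_ind (Q : int -> Prop) N :
  (forall n, N < n -> Q n) -> (forall s : nat, Q (N - s%:Z)) -> forall n, Q n.
Proof.
move=> hi lo n; have [/hi//|nN] := ltP N n.
by have -> : n = N - (absz (N - n))%:Z by lia.
Qed.

Fact mullC : commutative mull.
Proof.
move=> f g; apply: laurentP => /=.
have [N fN] := coeflB f; have [M gM] := coeflB g.
apply: (@low_ind _ (N + M)) => [n n_gt|s].
  by rewrite (mulc0 fN gM)// (mulc0 gM fN)// addrC.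
by rewrite (mulcE fN gM (ltnSn s)) mulrC [N + M]addrC (mulcE gM fN (ltnSn s)).
Qed.

Fact mullA : associative mull.
Proof.
move=> f g h; rewrite [RHS]mullC; apply: laurentP => /=.
have [N fN] := coeflB f; have [M gM] := coeflB g; have [L hL] := coeflB h.
have fgB := bnd_mulc fN gM; have ghB := bnd_mulc gM hL.
apply: (@low_ind _ (N + M + L)) => [n n_gt|s].
  rewrite (mulc0 fN ghB) ?addrA// (mulc0 hL fgB)//; lia.
transitivity ((P N s.+1 f * (P M s.+1 g * P L s.+1 h))`_s).
  have -> : N + M + L - s%:Z = N + (M + L) - s%:Z by lia.
  rewrite (mulcE fN ghB (ltnSn s)) mulrC [in RHS]mulrC.
  by apply: (coefM_low _ (ltnSn s)) => i; exact: P_mulc.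
have -> : N + M + L - s%:Z = L + (N + M) - s%:Z by lia.
rewrite (mulcE hL fgB (ltnSn s)) mulrA mulrC [in RHS]mulrC mulrC.
by apply: (coefM_low _ (ltnSn s)) => i im; rewrite [RHS]P_mulc.
Qed.

Fact mul1l : left_id onel mull.
Proof.
move=> f; apply: laurentP => n /=; rewrite (@mulc_seq _ _ _ [:: 0])//; last first.
  by move=> i; rewrite inE => /negPf i0; rewrite i0 mul0r.
by rewrite big_seq1 eqxx mul1r subr0.
Qed.

Fact mullDl : left_distributive mull addl.
Proof.
move=> f g h; apply: laurentP => /=.
have [N [fN gN]] := bnd2 f g; have [L hL] := coeflB h.
have fgN : bnd (addl f g) N by move=> n Nn /=; rewrite fN// gN// addr0.
apply: (@low_ind _ (N + L)) => [n n_gt|s].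
  by rewrite (mulc0 fgN hL)// (mulc0 fN hL)// (mulc0 gN hL)// addr0.
rewrite (mulcE fgN hL (ltnSn s)) (mulcE fN hL (ltnSn s)) (mulcE gN hL (ltnSn s)).
rewrite -coefD -mulrDl.
suff -> : P N s.+1 (addl f g) = P N s.+1 f + P N s.+1 g by [].
by apply/polyP => i; rewrite coefD !coef_poly; case: ifP => //; rewrite addr0.
Qed.

Fact onel_neq0 : onel != zerol.
Proof.
apply/eqP => /(congr1 (fun f : laurent k => f 0)) /= /eqP.
by rewrite oner_eq0.
Qed.

HB.instance Definition _ :=
  GRing.isZmodule.Build (laurent k) addlA addlC add0l addNl.
HB.instance Definition _ :=
  GRing.Zmodule_isComNzRing.Build (laurent k) mullA mullC mul1l mullDl onel_neq0.

Lemma coefl0 n : (0 : laurent k) n = 0. Proof. by []. Qed.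
Lemma coefl1 n : (1 : laurent k) n = (n == 0)%:R. Proof. by []. Qed.
Lemma coeflN f n : (- f) n = - f n. Proof. by []. Qed.
Lemma coeflD f g n : (f + g) n = f n + g n. Proof. by []. Qed.
Lemma coeflM f g n :
  (f * g) n = \sum_(i \in [set: int]) f i * g (n - i).
Proof. by []. Qed.

Let top f : f != 0 -> exists N, f N != 0 /\ bnd f N.
Proof.
move=> f0; have [N fN] := coeflB f.
have [s fs] : exists s : nat, f (N - s%:Z) != 0.
  apply: contrapT => /forallNP all0; move/eqP: f0; apply.
  apply: laurentP; apply: (@low_ind _ N) => [n /fN//|s].
  by apply/eqP; apply: contrapT => /negP; exact: all0.
have ex : exists s : nat, f (N - s%:Z) != 0 by exists s.
have [m fm min] := ex_minnP ex.
exists (N - m%:Z); split => // n n_gt.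
have [/fN//|nN] := ltP N n.
have E : n = N - (absz (N - n))%:Z by lia.
apply/eqP; apply: contrapT => /negP; rewrite E => /min; lia.
Qed.

Let invs (a : nat -> k) := fix invs (n : nat) : seq k :=
  if n isn't n'.+1 then [::] else
  rcons (invs n')
    (((n' == 0%N)%:R - \sum_(j < n') a (n' - j)%N * (invs n')`_j) / a 0%N).

Let invsP (a : nat -> k) : a 0%N != 0 -> exists b : nat -> k,
  forall n : nat, \sum_(j < n.+1) a j * b (n - j)%N = (n == 0%N)%:R.
Proof.
move=> a0; pose b (n : nat) := (invs a n.+1)`_n; exists b.
have sz (n : nat) : size (invs a n) = n by elim: n => //= n IH; rewrite size_rcons IH.
have bE (n m : nat) : (n < m)%N -> (invs a m)`_n = b n.
  elim: m => // m IH; rewrite ltnS leq_eqVlt => /predU1P[->//|nm].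
  by rewrite /= nth_rcons sz nm IH.
move=> n; rewrite big_ord_recl /= subn0.
have -> : b n = ((n == 0%N)%:R - \sum_(j < n) a (n - j)%N * b j) / a 0%N.
  rewrite {1}/b /= nth_rcons sz ltnn eqxx; congr ((_ - _) / _).
  by apply: eq_bigr => j _; rewrite bE.
rewrite mulrC divfK// [X in _ + X](reindex_inj rev_ord_inj) /=.
rewrite [X in _ + X](eq_bigr (fun j : 'I_n => a (n - j)%N * b j)) ?subrK//.
move=> j _; rewrite /bump /=; have js := ltn_ord j.
have -> : (1 + (n - j.+1) = n - j)%N by lia.
by rewrite subKn// ltnW.
Qed.

Fact mull_inv f : f != 0 -> exists g, g * f = 1.
Proof.
move=> /top [N [fN0 fN]].
have [|b bP] := @invsP (fun j => f (N - j%:Z)); first by rewrite subr0.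
pose v n : k := if - N < n then 0 else b (absz (- N - n)).
have vN : bnd v (- N) by move=> n n_gt; rewrite /v n_gt.
have vB : bounded_above v by exists (- N).
exists (Laurent vB); rewrite mulrC; apply: laurentP => /=.
apply: (@low_ind _ (N + - N)) => [n n_gt|s].
  by rewrite (mulc0 fN vN)//; case: eqP => // n0; lia.
rewrite (mulcE fN vN (ltnSn s)) coefM.
transitivity ((s == 0%N)%:R : k); last by congr (_%:R); congr nat_of_bool; lia.
rewrite -bP; apply: eq_bigr => j _; have js := ltn_ord j.
rewrite !coef_poly js ifT; last lia.
by rewrite /v ifF; [congr (_ * b _)|]; lia.
Qed.

Definition invl f : laurent k :=
  if pselect (f != 0) is left f0 then projT1 (cid (mull_inv f0)) else 0.

Fact mulVl f : f != 0 -> invl f * f = 1.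
Proof. by rewrite /invl; case: pselect => // f0 _; case: cid. Qed.

Fact invl0 : invl 0 = 0.
Proof. by rewrite /invl; case: pselect => // f0; have := f0; rewrite eqxx. Qed.

HB.instance Definition _ := GRing.ComNzRing_isField.Build (laurent k) mulVl invl0.

End LaurentField.

Section Subrings.
Variable k : fieldType.

Definition laurent_poly_coef (p : {poly k}) (n : int) : k :=
  if n is Posz m then p`_m else 0.

Fact laurent_poly_bounded p : bounded_above (laurent_poly_coef p).
Proof.
exists (size p)%:Z => -[n|//] /= pn; rewrite nth_default//.
by move: pn; lia.
Qed.

Definition laurent_poly (p : {poly k}) : laurent k :=
  Laurent (laurent_poly_bounded p).

(* k[t], inside k((t^-1)) *)
Definition polyS : {pred laurent k} :=
  fun f => `[< exists p : {poly k}, f = laurent_poly p >].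

(* k[[t^-1]], inside k((t^-1)) *)
Definition ringO : {pred laurent k} :=
  fun f => `[< forall n : int, 0 < n -> f n = 0 >].

Lemma polySE f : (f \in polyS) <-> forall n : int, n < 0 -> f n = 0.
Proof.
split=> [/asboolP[p ->] [//|n _]//|f0].
apply/asboolP; have [N fN] := coeflP f.
exists (\poly_(j < (absz N).+1) f j%:Z); apply: laurentP => -[m|m] /=; last first.
  by rewrite f0//; lia.
by rewrite coef_poly; case: ifPn => // Nm; rewrite fN//; lia.
Qed.

Fact polyS_subring : subring_closed polyS.
Proof.
split=> [|f g /polySE f0 /polySE g0|f g /polySE f0 /polySE g0]; apply/polySE => n n0.
- by rewrite coefl1 lt_eqF.
- by rewrite coeflD coeflN f0// g0// subr0.
- rewrite coeflM fsbig1// => i _; have [i0|i0] := ltP i 0.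
    by rewrite f0 ?mul0r.
  by rewrite (g0 (n - i)) ?mulr0//; lia.
Qed.

Fact ringO_subring : subring_closed ringO.
Proof.
split=> [|f g /asboolP f0 /asboolP g0|f g /asboolP f0 /asboolP g0];
  apply/asboolP => n n0.
- by rewrite coefl1 gt_eqF.
- by rewrite coeflD coeflN f0// g0// subr0.
- rewrite coeflM fsbig1// => i _; have [i0|i0] := ltP 0 i.
    by rewrite f0 ?mul0r.
  by rewrite (g0 (n - i)) ?mulr0//; lia.
Qed.

HB.instance Definition _ := GRing.isSubringClosed.Build (laurent k) polyS polyS_subring.
HB.instance Definition _ := GRing.isSubringClosed.Build (laurent k) ringO ringO_subring.

End Subrings.

Record GL (F : fieldType) (d : nat) := MkGL {
  glval :> 'M[F]_d;
  glP : glval \in unitmx }.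

HB.instance Definition _ (F : fieldType) d := [isSub for @glval F d].
HB.instance Definition _ (F : fieldType) d := [Choice of GL F d by <:].

Section GLgroup.
Variables (F : fieldType) (d : nat).

Fact gl1_unit : (1%:M : 'M[F]_d) \in unitmx. Proof. exact: unitmx1. Qed.
Fact glM_unit (g h : GL F d) : glval g *m glval h \in unitmx.
Proof. by rewrite unitmx_mul !glP. Qed.
Fact glV_unit (g : GL F d) : invmx (glval g) \in unitmx.
Proof. by rewrite unitmx_inv glP. Qed.

Definition gl1 := MkGL gl1_unit.
Definition glM g h := MkGL (glM_unit g h).
Definition glV g := MkGL (glV_unit g).

Fact glMA : associative glM.
Proof. by move=> g h l; apply: val_inj => /=; rewrite mulmxA. Qed.
Fact gl1M : left_id gl1 glM.
Proof. by move=> g; apply: val_inj => /=; rewrite mul1mx. Qed.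
Fact glM1 : right_id gl1 glM.
Proof. by move=> g; apply: val_inj => /=; rewrite mulmx1. Qed.
Fact glMV : left_inverse gl1 glV glM.
Proof. by move=> g; apply: val_inj => /=; rewrite mulVmx// glP. Qed.
Fact glVM : right_inverse gl1 glV glM.
Proof. by move=> g; apply: val_inj => /=; rewrite mulmxV// glP. Qed.

HB.instance Definition _ := isGroup.Build (GL F d) glMA gl1M glM1 glMV glVM.

Lemma val_glM (g h : GL F d) : glval (g * h)%g = glval g *m glval h.
Proof. by []. Qed.
Lemma val_glV (g : GL F d) : glval g^-1%g = invmx (glval g).
Proof. by []. Qed.
Lemma val_gl1 : glval (1 : GL F d)%g = 1%:M.
Proof. by []. Qed.

Definition homothetic (g h : GL F d) : bool :=
  `[< exists2 c : F, c != 0 & glval h = c *: glval g >].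

Fact homothetic_refl : reflexive homothetic.
Proof. by move=> g; apply/asboolP; exists 1; rewrite ?oner_eq0// scale1r. Qed.

Let homothetic_symW g h : homothetic g h -> homothetic h g.
Proof.
move=> /asboolP[c c0 E]; apply/asboolP; exists c^-1; rewrite ?invr_eq0//.
by rewrite E scalerA mulVf// scale1r.
Qed.

Fact homothetic_sym : symmetric homothetic.
Proof. by move=> g h; apply/idP/idP; exact: homothetic_symW. Qed.

Fact homothetic_trans : transitive homothetic.
Proof.
move=> h g l /asboolP[c c0 E] /asboolP[e e0 E']; apply/asboolP.
by exists (e * c); [rewrite mulf_neq0|rewrite E' E scalerA].
Qed.

Canonical homothetic_equiv :=
  EquivRel homothetic homothetic_refl homothetic_sym homothetic_trans.

End GLgroup.

Definition PGL (F : fieldType) (d : nat) := {eq_quot @homothetic F d}.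

HB.instance Definition _ (F : fieldType) d := Choice.on (PGL F d).
HB.instance Definition _ (F : fieldType) d := EqQuotient.on (PGL F d).

Section PGLgroup.
Local Open Scope quotient_scope.
Variables (F : fieldType) (d : nat).
Local Notation PGL := (PGL F d).

Definition pgl1 : PGL := \pi_PGL 1%g.
Definition pglM : PGL -> PGL -> PGL := lift_op2 PGL (fun g h => g * h)%g.
Definition pglV : PGL -> PGL := lift_op1 PGL (fun g => g^-1)%g.

Let piP (g h : GL F d) : reflect (\pi_PGL g = \pi_PGL h) (homothetic g h).
Proof. exact: eqmodP. Qed.

Let repr_pi (g : GL F d) :
  exists2 c : F, c != 0 & glval (repr (\pi_PGL g)) = c *: glval g.
Proof. by apply/asboolP/(piP g); rewrite reprK. Qed.

Lemma pi_pglM (g h : GL F d) : pglM (\pi_PGL g) (\pi_PGL h) = \pi_PGL (g * h)%g.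
Proof.
have [c c0 E] := repr_pi g; have [e e0 E'] := repr_pi h.
rewrite /pglM -lock; apply/esym/piP/asboolP.
exists (c * e); first by rewrite mulf_neq0.
by rewrite !val_glM E E' -scalemxAl -scalemxAr scalerA.
Qed.

Lemma pi_pglV (g : GL F d) : pglV (\pi_PGL g) = \pi_PGL g^-1%g.
Proof.
have [c c0 E] := repr_pi g.
rewrite /pglV -lock; apply/esym/piP/asboolP; exists c^-1; first by rewrite invr_eq0.
by rewrite !val_glV E invmxZ// -E glP.
Qed.

Fact pglMA : associative pglM.
Proof.
by elim/quotW=> g; elim/quotW=> h; elim/quotW=> l; rewrite !pi_pglM mulgA.
Qed.
Fact pgl1M : left_id pgl1 pglM.
Proof. by elim/quotW=> g; rewrite /pgl1 pi_pglM mul1g. Qed.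
Fact pglM1 : right_id pgl1 pglM.
Proof. by elim/quotW=> g; rewrite /pgl1 pi_pglM mulg1. Qed.
Fact pglMV : left_inverse pgl1 pglV pglM.
Proof. by elim/quotW=> g; rewrite pi_pglV pi_pglM mulVg. Qed.
Fact pglVM : right_inverse pgl1 pglV pglM.
Proof. by elim/quotW=> g; rewrite pi_pglV pi_pglM mulgV. Qed.

HB.instance Definition _ := isGroup.Build PGL pglMA pgl1M pglM1 pglMV pglVM.

Lemma piPGL_M (g h : GL F d) : \pi_PGL (g * h)%g = (\pi_PGL g * \pi_PGL h)%g.
Proof. by rewrite -pi_pglM. Qed.
Lemma piPGL_V (g : GL F d) : \pi_PGL g^-1%g = (\pi_PGL g)^-1%g.
Proof. by rewrite -pi_pglV. Qed.
Lemma piPGL_1 : \pi_PGL 1%g = 1%g.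
Proof. by []. Qed.

(* The image of GL_d(S) in PGL_d(F), for a subring S of F. *)
Definition PGL_over (S : {pred F}) : {pred PGL} :=
  fun x => `[< exists g : GL F d,
    [/\ glval g \is a mxOver S, glval g^-1%g \is a mxOver S & x = \pi_PGL g] >].

Section Closed.
Variable S : subringClosed F.

Fact PGL_over1 : 1%g \in PGL_over S.
Proof.
apply/asboolP; exists 1%g; rewrite invg1 val_gl1; split=> //;
  by apply: mxOver_scalar; rewrite ?rpred0 ?rpred1.
Qed.

Fact PGL_overM : mulg_closed (PGL_over S).
Proof.
move=> x y /asboolP[g [g1 g2 ->]] /asboolP[h [h1 h2 ->]].
apply/asboolP; exists (g * h)%g; split; last by rewrite piPGL_M.
  exact: mxOverM.
by rewrite invgM; exact: mxOverM.
Qed.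

Fact PGL_overV : invg_closed (PGL_over S).
Proof.
move=> x /asboolP[g [g1 g2 ->]]; apply/asboolP; exists g^-1%g.
by rewrite invgK piPGL_V.
Qed.

HB.instance Definition _ := isMulClosed.Build PGL (PGL_over S) PGL_overM.
HB.instance Definition _ := isMul1Closed.Build PGL (PGL_over S) PGL_over1.
HB.instance Definition _ := isInvClosed.Build PGL (PGL_over S) PGL_overV.
End Closed.

End PGLgroup.

Section DoubleCosets.
Variables (G : groupType) (A B : groupClosed G).

Definition same_dcoset (g h : G) : bool :=
  `[< exists a b : G, [/\ a \in A, b \in B & h = a * g * b]%g >].

Fact same_dcoset_refl : reflexive same_dcoset.
Proof.
by move=> g; apply/asboolP; exists 1%g, 1%g; rewrite !gpred1 mul1g mulg1.
Qed.

Let same_dcoset_symW g h : same_dcoset g h -> same_dcoset h g.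
Proof.
move=> /asboolP[a [b [Aa Bb ->]]]; apply/asboolP.
exists a^-1%g, b^-1%g; rewrite !gpredV; split=> //.
by rewrite !mulgA mulVg mul1g -mulgA mulgV mulg1.
Qed.

Fact same_dcoset_sym : symmetric same_dcoset.
Proof. by move=> g h; apply/idP/idP; exact: same_dcoset_symW. Qed.

Fact same_dcoset_trans : transitive same_dcoset.
Proof.
move=> h g l /asboolP[a [b [Aa Bb ->]]] /asboolP[a' [b' [Aa' Bb' ->]]].
apply/asboolP; exists (a' * a)%g, (b * b')%g; rewrite !gpredM//.
by split=> //; rewrite !mulgA.
Qed.

Canonical same_dcoset_equiv :=
  EquivRel same_dcoset same_dcoset_refl same_dcoset_sym same_dcoset_trans.

(* The double coset space A \ G / B. *)
Definition dcosets := {eq_quot same_dcoset}.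

HB.instance Definition _ := Choice.on dcosets.
HB.instance Definition _ := EqQuotient.on dcosets.
HB.instance Definition _ := isPointed.Build dcosets (\pi_dcosets 1%g)%qT.

End DoubleCosets.

Section TrivialSubgroup.
Variable G : groupType.

Definition trivial_subgroup : {pred G} := pred1 1%g.

Fact trivial_subgroup1 : 1%g \in trivial_subgroup.
Proof. exact: eqxx. Qed.
Fact trivial_subgroupM : mulg_closed trivial_subgroup.
Proof. by move=> _ _ /eqP-> /eqP->; rewrite mulg1; exact: eqxx. Qed.
Fact trivial_subgroupV : invg_closed trivial_subgroup.
Proof. by move=> _ /eqP->; rewrite invg1; exact: eqxx. Qed.

HB.instance Definition _ := isMulClosed.Build G trivial_subgroup trivial_subgroupM.
HB.instance Definition _ := isMul1Closed.Build G trivial_subgroup trivial_subgroup1.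
HB.instance Definition _ := isInvClosed.Build G trivial_subgroup trivial_subgroupV.

End TrivialSubgroup.

Section Haar.
Local Open Scope quotient_scope.
Variables (k : finFieldType) (d : nat).
Local Notation F := (laurent k).
Local Notation G := (PGL F d).

Definition Gamma : groupClosed G := @PGL_over F d (@polyS k).
Definition maxK : groupClosed G := @PGL_over F d (@ringO k).

HB.instance Definition _ := isPointed.Build G 1%g.

(* The quotient topology of GL_d(F) -> G, where GL_d(F) carries the topology of
   entrywise convergence and the t^-n k[[t^-1]] (n : nat) are a neighbourhood
   basis of 0 in F. *)
Definition PGL_open (U : set G) :=
  forall g : GL F d, U (\pi_G g) ->
  exists n : nat, forall h : GL F d,
    (forall i j (m : int), - n%:Z < m -> (glval h i j - glval g i j) m = 0) ->
    U (\pi_G h).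

HB.instance Definition _ := Measurable.copy G (g_sigma_algebraType PGL_open).

Section QuotientSigmaAlgebra.
Variables A B : groupClosed G.

(* The quotient sigma-algebra.  As Gamma is discrete, on Gamma \ G it is the
   Borel one; as maxK is open, on Gamma \ G / maxK every set belongs to it. *)
Definition dcosets_measurable : set (set (dcosets A B)) :=
  [set U | measurable ((fun g : G => \pi_(dcosets A B) g) @^-1` U)].

Fact dcosets_measurable0 : dcosets_measurable set0.
Proof. by rewrite /dcosets_measurable/= preimage_set0. Qed.

Fact dcosets_measurableC U :
  dcosets_measurable U -> dcosets_measurable (~` U).
Proof. by move=> mU; rewrite /dcosets_measurable/= preimage_setC; exact: measurableC. Qed.

Fact dcosets_measurable_bigcup (U : (set (dcosets A B))^nat) :
  (forall i, dcosets_measurable (U i)) -> dcosets_measurable (\bigcup_i U i).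
Proof.
by move=> mU; rewrite /dcosets_measurable/= preimage_bigcup; exact: bigcupT_measurable.
Qed.

HB.instance Definition _ := @isMeasurable.Build default_measure_display
  (dcosets A B) dcosets_measurable dcosets_measurable0 dcosets_measurableC
  dcosets_measurable_bigcup.

End QuotientSigmaAlgebra.

Definition Gamma_G := dcosets Gamma (@trivial_subgroup G).
Definition Y := dcosets Gamma maxK.

Definition to_Y (x : Gamma_G) : Y := \pi_Y (repr x).

Lemma to_Y_pi (g : G) : to_Y (\pi_Gamma_G g) = \pi_Y g.
Proof.
apply/eqmodP.
have /eqmodP/asboolP[a [b [Aa /eqP bE gE]]] :
  repr (\pi_Gamma_G g) = g %[mod Gamma_G] by rewrite reprK.
by apply/asboolP; exists a, b; split=> //; rewrite bE gpred1.
Qed.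

Variable R : realType.
Local Open Scope ereal_scope.

Definition is_Haar (mu : {measure set G -> \bar R}) :=
  (forall (g : G) (A : set G), measurable A ->
     mu [set (g * x)%g | x in A] = mu A) /\
  mu [set` maxK] = 1.

(* The quotient of mu by the counting measure of the discrete group Gamma. *)
Definition is_quotient_measure (mu : {measure set G -> \bar R})
    (mubar : {measure set Gamma_G -> \bar R}) :=
  forall f : G -> \bar R, measurable_fun [set: G] f -> (forall g, 0 <= f g) ->
  \int[mu]_g f g =
  \int[mubar]_x \esum_(c in [set` Gamma]) f (c * repr x)%g.

(* Gamma `&` g K g^-1 *)
Definition stabilizer (g : G) : set G :=
  [set x | x \in Gamma /\ (g^-1 * x * g)%g \in maxK].

Definition vertex_mass (y : Y) : \bar R := (counting (stabilizer (repr y)))^-1.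

Lemma stabilizer_dcoset (a g b : G) : a \in Gamma -> b \in maxK ->
  stabilizer (a * g * b)%g = [set (a * x * a^-1)%g | x in stabilizer g].
Proof.
move=> Aa Bb; apply/seteqP; split=> [x [xG xK]|_ [x [xG xK] <-]].
  exists (a^-1 * x * a)%g; last by rewrite !mulgA mulgV mul1g mulgK.
  split; first by rewrite !gpredM ?gpredV.
  have -> : (g^-1 * (a^-1 * x * a) * g =
             b * ((a * g * b)^-1 * x * (a * g * b)) * b^-1)%g.
    by rewrite !invgM !mulgA mulgV mul1g mulgK.
  by rewrite gpredM ?gpredV// gpredM.
split; first by rewrite !gpredM ?gpredV.
have -> : ((a * g * b)^-1 * (a * x * a^-1) * (a * g * b) =
           b^-1 * (g^-1 * x * g) * b)%g.
  by rewrite !invgM !mulgA !mulgVK.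
by rewrite gpredM// gpredM ?gpredV.
Qed.

Lemma vertex_mass_pi (g : G) :
  vertex_mass (\pi_Y g) = (counting (stabilizer g))^-1.
Proof.
have /eqmodP/asboolP[a [b [Aa Bb E]]] : g = repr (\pi_Y g) %[mod Y].
  by rewrite reprK.
rewrite /vertex_mass E stabilizer_dcoset//; congr (_^-1).
set S := stabilizer g; pose f (x : G) : G := (a * x * a^-1)%g.
have f_inj : injective f.
  by move=> x y /(congr1 (fun z => a^-1 * z * a)%g); rewrite /f !mulgA mulVg !mul1g !mulgVK.
have [finS|infS] := pselect (finite_set S).
  have finfS : finite_set (f @` S) by exact: finite_image.
  by rewrite /counting !asboolT// fset_set_image// card_imfset.
rewrite /counting !asboolF//; apply: contra_not infS => finfS.
by rewrite -(eq_finite_set (@inj_card_eq _ _ S f (in2W f_inj))).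
Qed.

Definition vertex_volume : \bar R := \esum_(y in [set: Y]) vertex_mass y.

End Haar.

(* Main.v *)
(* Reduction of polynomial lattices writes every g in GL_d(F) as
   gamma diag(t^s_1, ..., t^s_d) kappa, and the nonincreasing sequences s with
   s_d = 0 parametrize Y bijectively.  The stabilizer of the vertex s is the
   quotient by k^* of the group of the invertible polynomial matrices P with
   deg P_ij <= s_i - s_j.  Let w(s) be the inverse of the order of this group.
   Splitting off the m smallest parts of s gives
     w((t + 1) ++ 0^m) = w(t) / (|GL_m(k)| q^(m (|t| + 2 (d - m)))),
   so that F_d(z) = sum_s w(s) z^|s|, over all nonincreasing s of length d,
   satisfies a recursion in d whose solution is
     F_d(z) = 1 / prod_(1 <= i <= d) (q^i - 1) / prod_(0 <= i < d) (q^i - z),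
   by the q-binomial identity [qcoef_sum].  The sum over s with s_d = 0 is
   (1 - z^d) F_d(z), and z -> 1 gives the volume.  For the quotient measure,
   integrating the indicator function of g K shows that the fiber over
   Gamma g K has mass 1 / |Gamma cap g K g^-1|. *)

Require Import Defs.
From HB Require Import structures.
From mathcomp Require Import all_boot all_order all_fingroup all_algebra.
From mathcomp Require Import finmap zify ring.
From mathcomp Require Import all_classical all_reals all_analysis.
From mathcomp Require Import measurable_realfun.

Set Implicit Arguments.
Unset Strict Implicit.
Unset Printing Implicit Defensive.

Import Order.TTheory GRing.Theory Num.Theory.

Local Open Scope classical_set_scope.
Local Open Scope ring_scope.

(** * Degrees of Laurent series, monomials, and the embedding of k[t] *)

Section LaurentDegree.
Variable k : fieldType.
Implicit Types (f g : laurent k) (N M n : int).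

(** The zero series satisfies every bound [deg_le] and has no exact degree [has_deg], so no degree
    of 0 has to be fixed. *)
Definition deg_le f N := forall n, N < n -> f n = 0.
Definition has_deg f N := f N != 0 /\ deg_le f N.

Lemma deg_leW f N M : N <= M -> deg_le f N -> deg_le f M.
Proof. by move=> NM fN n Mn; apply: fN; apply: le_lt_trans Mn. Qed.

Lemma deg_le0 N : deg_le 0 N. Proof. by []. Qed.

Lemma deg_leD f g N : deg_le f N -> deg_le g N -> deg_le (f + g) N.
Proof. by move=> fN gN n Nn; rewrite coeflD fN// gN// addr0. Qed.

Lemma coefl_sum I (r : seq I) (P : pred I) (F : I -> laurent k) n :
  (\sum_(i <- r | P i) F i) n = \sum_(i <- r | P i) (F i n).
Proof. by elim/big_rec2: _ => // i x y _ <-; rewrite coeflD. Qed.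

Lemma deg_le_sum I (r : seq I) (P : pred I) (F : I -> laurent k) N :
  (forall i, P i -> deg_le (F i) N) -> deg_le (\sum_(i <- r | P i) F i) N.
Proof. by move=> FN n Nn; rewrite coefl_sum big1// => i Pi; exact: FN. Qed.

Lemma coeflM_supp f g n N : (forall i, i != N -> f i * g (n - i) = 0) ->
  (f * g) n = f N * g (n - N).
Proof.
move=> h; rewrite coeflM (fsbigE [:: N])//.
  by rewrite big_mkcond/= big_seq1 in_setT.
by move=> i _; rewrite inE; exact: h.
Qed.

Lemma deg_leM f g N M : deg_le f N -> deg_le g M -> deg_le (f * g) (N + M).
Proof.
move=> fN gM n n_gt; rewrite coeflM fsbig1// => i _.
have [iN|iN] := ltP N i; first by rewrite fN ?mul0r.
by rewrite (gM (n - i)) ?mulr0//; lia.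
Qed.

Lemma coeflM_top f g N M : deg_le f N -> deg_le g M ->
  (f * g) (N + M) = f N * g M.
Proof.
move=> fN gM; rewrite (@coeflM_supp _ _ _ N); first by congr (_ * g _); lia.
move=> i iN; have [Ni|Ni] := ltP N i; first by rewrite fN ?mul0r.
by rewrite (gM (_ - i)) ?mulr0//; lia.
Qed.

Lemma deg_le1 : deg_le 1 0.
Proof. by move=> n n0; rewrite coefl1 gt_eqF. Qed.

Lemma deg_le_prod I (r : seq I) (P : pred I) (F : I -> laurent k)
    (N : I -> int) : (forall i, P i -> deg_le (F i) (N i)) ->
  deg_le (\prod_(i <- r | P i) F i) (\sum_(i <- r | P i) N i) /\
  (\prod_(i <- r | P i) F i) (\sum_(i <- r | P i) N i) =
    \prod_(i <- r | P i) (F i (N i)).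
Proof.
move=> FN; elim: r => [|i r [IH1 IH2]].
  by rewrite !big_nil; split; [exact: deg_le1|rewrite coefl1 eqxx].
rewrite !big_cons; case: ifP => // Pi; split; first exact: deg_leM (FN _ Pi) _.
by rewrite coeflM_top ?IH2//; exact: FN.
Qed.

Lemma coefl_sign (b : bool) f n : ((-1) ^+ b * f) n = (-1) ^+ b * f n.
Proof. by case: b; rewrite ?expr0 ?expr1 ?mulN1r ?mul1r. Qed.

(** Each Leibniz term takes one entry from every row: its degree is at most the sum of the row
    bounds, and its coefficient there is the product of the coefficients at those bounds. *)
Lemma coefl_det_top d (g : 'M[laurent k]_d) (r : 'I_d -> int) :
  (forall i j, deg_le (g i j) (r i)) ->
  deg_le (\det g) (\sum_i r i) /\
  (\det g) (\sum_i r i) = \det (\matrix_(i, j) g i j (r i)).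
Proof.
move=> gr.
have pr (s : 'S_d) := @deg_le_prod _ (index_enum 'I_d) xpredT
  (fun i => g i (s i)) r (fun i _ => gr i (s i)).
split.
  apply: deg_le_sum => s _ n n_gt; rewrite coefl_sign.
  by have [h _] := pr s; rewrite h ?mulr0.
rewrite coefl_sum; apply: eq_bigr => s _; rewrite coefl_sign; congr (_ * _).
by have [_ ->] := pr s; apply: eq_bigr => i _; rewrite mxE.
Qed.

Lemma ringOP f : reflect (deg_le f 0) (f \in @ringO k).
Proof. exact: asboolP. Qed.

Lemma has_deg_ex f : f != 0 -> exists N, has_deg f N.
Proof.
move=> f0; have [N fN] := coeflP f.
have ex : exists s : nat, f (N - s%:Z) != 0.
  apply: contrapT => /forallNP all0; move/eqP: f0; apply.
  apply: laurentP => n; have [/fN//|nN] := ltP N n.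
  have -> : n = N - (absz (N - n))%:Z by lia.
  by apply/eqP; apply: contrapT => /negP; exact: all0.
have [m fm min] := ex_minnP ex.
exists (N - m%:Z); split => // n n_gt.
have [/fN//|nN] := ltP N n.
have E : n = N - (absz (N - n))%:Z by lia.
by apply/eqP; apply: contrapT => /negP; rewrite E => /min; lia.
Qed.

Lemma has_deg_le f N M : has_deg f N -> deg_le f M -> N <= M.
Proof.
by move=> [/eqP fN _] fM; rewrite leNgt; apply/negP => /fM.
Qed.

Lemma has_deg_uniq f N M : has_deg f N -> has_deg f M -> N = M.
Proof.
move=> fN fM; apply/eqP; rewrite eq_le.
by rewrite (has_deg_le fN fM.2) (has_deg_le fM fN.2).
Qed.

Lemma has_degM f g N M : has_deg f N -> has_deg g M -> has_deg (f * g) (N + M).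
Proof.
move=> [f0 fN] [g0 gM]; split; last exact: deg_leM.
by rewrite coeflM_top// mulf_neq0.
Qed.

Lemma has_deg1 : has_deg 1 0.
Proof. by split; [rewrite coefl1 eqxx oner_eq0|exact: deg_le1]. Qed.

Lemma has_degX f N m : has_deg f N -> has_deg (f ^+ m) (N *+ m).
Proof.
move=> fN; elim: m => [|m IH]; first exact: has_deg1.
by rewrite exprS mulrS; exact: has_degM.
Qed.

Lemma has_degV f N : has_deg f N -> has_deg f^-1 (- N).
Proof.
move=> fN; have f0 : f != 0.
  by apply/eqP => f0; have [] := fN; rewrite f0 coefl0 eqxx.
have [M fM] : exists M, has_deg f^-1 M by apply: has_deg_ex; rewrite invr_eq0.
have := has_degM fN fM; rewrite mulfV// => /(has_deg_uniq has_deg1) E.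
by have -> : - N = M by lia.
Qed.

Fact tpow_bounded N : bounded_above (fun n => (n == N)%:R : k).
Proof. by exists N => n n0; rewrite gt_eqF. Qed.

Definition tpow N := Laurent (tpow_bounded N).

Lemma coefl_tpow N n : tpow N n = (n == N)%:R. Proof. by []. Qed.

Lemma coefl_tpowM N f n : (tpow N * f) n = f (n - N).
Proof.
rewrite (@coeflM_supp _ _ _ N) ?coefl_tpow ?eqxx ?mul1r// => i /negPf iN.
by rewrite coefl_tpow iN mul0r.
Qed.

Lemma tpowD N M : tpow (N + M) = tpow N * tpow M.
Proof.
by apply: laurentP => n; rewrite coefl_tpowM !coefl_tpow; congr (_%:R); lia.
Qed.

Lemma tpow0 : tpow 0 = 1. Proof. by apply: laurentP. Qed.

Lemma has_deg_tpow N : has_deg (tpow N) N.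
Proof.
by split=> [|n n_gt]; rewrite coefl_tpow ?eqxx ?oner_eq0// gt_eqF.
Qed.

Lemma tpow_neq0 N : tpow N != 0.
Proof.
by apply/eqP => E; have [] := has_deg_tpow N; rewrite E eqxx.
Qed.

Lemma prod_tpow (I : finType) (r : I -> int) :
  \prod_i tpow (r i) = tpow (\sum_i r i).
Proof.
by apply/esym; exact: (big_morph _ tpowD tpow0).
Qed.

Lemma polyS_has_deg f N : f \in @polyS k -> has_deg f N -> 0 <= N.
Proof.
move=> /polySE f0 [/eqP fN _]; rewrite leNgt; apply/negP => N0.
by apply: fN; exact: f0.
Qed.

Lemma laurent_polyE (p : {poly k}) n :
  laurent_poly p n = if n is Posz m then p`_m else 0.
Proof. by []. Qed.

Lemma laurent_poly_inj : injective (@laurent_poly k).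
Proof.
move=> p r E; apply/polyP => i.
by have := congr1 (fun f : laurent k => f i%:Z) E.
Qed.

Fact laurent_poly_zmod : zmod_morphism (@laurent_poly k).
Proof.
move=> p r; apply: laurentP => -[m|m]; rewrite coeflD coeflN /= ?subr0//.
by rewrite coefB.
Qed.

Lemma coefl_polyC_M c f n : (laurent_poly c%:P * f) n = c * f n.
Proof.
rewrite (@coeflM_supp _ _ _ 0).
  by rewrite subr0 -[laurent_poly _ 0]/(c%:P`_0) coefC.
by case=> [[|i]|i]// _; rewrite laurent_polyE ?coefC/= ?mul0r.
Qed.

Lemma laurent_polyC_M c (p : {poly k}) :
  laurent_poly (c%:P * p) = laurent_poly c%:P * laurent_poly p.
Proof.
apply: laurentP => n; rewrite coefl_polyC_M !laurent_polyE.
by case: n => n; rewrite ?mulr0// coefCM.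
Qed.

Lemma laurent_polyX_M (p : {poly k}) :
  laurent_poly ('X * p) = tpow 1 * laurent_poly p.
Proof.
apply: laurentP => n; rewrite coefl_tpowM.
case: n => [[|n]|n]; rewrite !laurent_polyE ?coefXM//=.
by rewrite subn1.
Qed.

Fact laurent_poly_monoid : monoid_morphism (@laurent_poly k).
Proof.
split.
  apply: laurentP => n; rewrite coefl1 laurent_polyE.
  by case: n => // n; rewrite coefC; case: n.
move=> p r; elim/poly_ind: p => [|p c IH].
  have -> : laurent_poly 0 = 0 :> laurent k.
    by apply: laurentP => -[n|n]; rewrite coefl0 laurent_polyE ?coef0.
  rewrite !mul0r.
  by apply: laurentP => -[n|n]; rewrite coefl0 laurent_polyE ?coef0.
have D (u v : {poly k}) : laurent_poly (u + v) = laurent_poly u + laurent_poly v.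
  by apply: laurentP => -[m|m]; rewrite coeflD /= ?addr0// coefD.
by rewrite mulrDl !D mulrDl laurent_polyC_M [p * 'X]mulrC -mulrA !laurent_polyX_M
  IH mulrA.
Qed.

HB.instance Definition _ := GRing.isZmodMorphism.Build {poly k} (laurent k)
  (@laurent_poly k) laurent_poly_zmod.
HB.instance Definition _ := GRing.isMonoidMorphism.Build {poly k} (laurent k)
  (@laurent_poly k) laurent_poly_monoid.

Lemma laurent_polyXn m : laurent_poly 'X^m = tpow m%:Z.
Proof.
apply: laurentP => -[n|n]; rewrite coefl_tpow /= ?coefXn//.
Qed.

Lemma laurent_poly_polyS (p : {poly k}) : laurent_poly p \in @polyS k.
Proof. by apply/asboolP; exists p. Qed.

End LaurentDegree.

(** * Matrices as representatives of classes in PGL_d *)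

Section PGLMatrix.
Variables (F : fieldType) (d : nat).
Implicit Types (M N : 'M[F]_d).

(** Total on matrices, so that products need no bundled proof of invertibility; a singular matrix
    gets the class of the identity. *)
Definition pi_mx M : PGL F d := (\pi_(PGL F d) (insubd (1%g : GL F d) M))%qT.

Lemma val_insubd_unit M : M \in unitmx -> glval (insubd (1%g : GL F d) M) = M.
Proof. by move=> Mu; rewrite -[LHS]/(val _) val_insubd Mu. Qed.

Lemma pi_mx_glval (g : GL F d) : pi_mx (glval g) = (\pi_(PGL F d) g)%qT.
Proof.
congr (\pi_(PGL F d) _)%qT; apply: val_inj.
by rewrite /= val_insubd_unit// glP.
Qed.

Lemma pi_mx_surj x : exists2 M, M \in unitmx & x = pi_mx M.
Proof.
by elim/quotW: x => g; exists (glval g); [exact: glP|rewrite pi_mx_glval].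
Qed.

Lemma pi_mxM M N : M \in unitmx -> N \in unitmx ->
  pi_mx (M *m N) = (pi_mx M * pi_mx N)%g.
Proof.
move=> Mu Nu; rewrite /pi_mx -piPGL_M; congr (\pi_(PGL F d) _)%qT.
by apply: val_inj; rewrite /= !val_insubd_unit// unitmx_mul Mu.
Qed.

Lemma pi_mxV M : M \in unitmx -> pi_mx (invmx M) = (pi_mx M)^-1%g.
Proof.
move=> Mu; rewrite /pi_mx -piPGL_V; congr (\pi_(PGL F d) _)%qT.
by apply: val_inj; rewrite /= !val_insubd_unit// unitmx_inv.
Qed.

Lemma pi_mx_eq M N : M \in unitmx -> N \in unitmx ->
  pi_mx M = pi_mx N <-> exists2 c : F, c != 0 & N = c *: M.
Proof.
move=> Mu Nu; split.
  by move=> /eqmodP/asboolP[c c0]; rewrite !val_insubd_unit// => E; exists c.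
move=> [c c0 E]; apply/eqmodP/asboolP; exists c => //.
by rewrite !val_insubd_unit.
Qed.

Definition GL_in (S : {pred F}) M :=
  [/\ M \in unitmx, M \is a mxOver S & invmx M \is a mxOver S].

Lemma PGL_overP (S : {pred F}) x :
  x \in PGL_over (d := d) S <-> exists2 M, GL_in S M & x = pi_mx M.
Proof.
split=> [/asboolP[g [gS gS' ->]]|[M [Mu MS MS'] ->]].
  by exists (glval g); [split=> //; exact: glP|rewrite pi_mx_glval].
apply/asboolP; exists (insubd (1%g : GL F d) M); split=> //.
  by rewrite val_insubd_unit.
by rewrite val_glV val_insubd_unit.
Qed.

Variable S : subringClosed F.

Lemma GL_in_inv M : GL_in S M -> GL_in S (invmx M).
Proof. by move=> [Mu MS MS']; split; rewrite ?unitmx_inv ?invmxK. Qed.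

Lemma invmxM M N : M \in unitmx -> N \in unitmx ->
  invmx (M *m N) = invmx N *m invmx M.
Proof.
move=> Mu Nu; have MNu : M *m N \in unitmx by rewrite unitmx_mul Mu.
rewrite -[RHS]mul1mx -(mulVmx MNu) -!mulmxA [N *m (_ *m _)]mulmxA.
by rewrite mulmxV// mul1mx mulmxV// mulmx1.
Qed.

Lemma GL_inM M N : GL_in S M -> GL_in S N -> GL_in S (M *m N).
Proof.
move=> [Mu MS MS'] [Nu NS NS']; split; first by rewrite unitmx_mul Mu.
  exact: mxOverM.
by rewrite invmxM//; exact: mxOverM.
Qed.

Lemma GL_in_perm (s : 'S_d) : GL_in S (perm_mx s).
Proof.
have pS (t : 'S_d) : perm_mx t \is a mxOver S.
  by apply/mxOverP => i j; rewrite !mxE; case: eqP; rewrite ?rpred0 ?rpred1.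
split; rewrite ?unitmx_perm//.
have -> : invmx (perm_mx s) = perm_mx s^-1 :> 'M[F]_d; last exact: pS.
rewrite -[LHS]mul1mx -(perm_mx1 F) -(mulVg s) perm_mxM -mulmxA mulmxV ?mulmx1//.
exact: unitmx_perm.
Qed.

Lemma rpred_det M : M \is a mxOver S -> \det M \in S.
Proof.
move=> /mxOverP MS; apply: rpred_sum => s _; apply: rpredM; last exact: rpred_prod.
by rewrite rpredX// rpredN rpred1.
Qed.

End PGLMatrix.

Lemma rpred_adj (F : fieldType) d (S : subringClosed F) (M : 'M[F]_d) :
  M \is a mxOver S -> \adj M \is a mxOver S.
Proof.
move=> /mxOverP MS; apply/mxOverP => i j; rewrite mxE; apply: rpredM.
  by rewrite rpredX// rpredN rpred1.
by apply: rpred_det; apply/mxOverP => a b; rewrite !mxE.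
Qed.

(** * Invertible matrices over k[t] and k[[1/t]], and diagonal matrices of monomials *)

Section LaurentMatrix.
Variables (k : fieldType) (d : nat).
Local Notation F := (laurent k).
Implicit Types (M : 'M[F]_d).

(** The determinant has degree exactly 0, so its inverse is integral as well, and the adjugate
    formula makes the inverse matrix integral. *)
Lemma GL_in_ringO M : M \is a mxOver (@ringO k) -> (\det M) 0 != 0 ->
  GL_in (@ringO k) M.
Proof.
move=> MO detM.
have dd : has_deg (\det M) 0 by split=> //; apply/ringOP; exact: rpred_det.
have Mu : M \in unitmx.
  by rewrite unitmxE unitfE; apply: contraNneq detM => ->; rewrite coefl0.
split=> //; rewrite /invmx Mu; apply/mxOverP => i j; rewrite mxE rpredM//.
  by apply/ringOP; have [_] := has_degV dd; rewrite oppr0.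
exact/mxOverP/rpred_adj.
Qed.

Lemma det_GL_inV (S : subringClosed F) M : GL_in S M ->
  [/\ \det M \in S, \det (invmx M) \in S & \det (invmx M) = (\det M)^-1].
Proof.
by move=> [Mu MS MS']; rewrite det_inv; split=> //; rewrite -?det_inv;
  exact: rpred_det.
Qed.

Lemma det_unit_has_deg M : M \in unitmx -> exists N, has_deg (\det M) N.
Proof. by rewrite unitmxE unitfE => ?; exact: has_deg_ex. Qed.

(** The degrees of the determinant and of its inverse are opposite and both at most 0; over k[t] the
    same argument runs with both at least 0. *)
Lemma det_ringO M : GL_in (@ringO k) M -> has_deg (\det M) 0.
Proof.
move=> MO; have [Mu _ _] := MO; have [/ringOP h /ringOP + E] := det_GL_inV MO.
rewrite E; have [N dN] := det_unit_has_deg Mu.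
move=> /(has_deg_le (has_degV dN)) N0; have := has_deg_le dN h.
by move=> N0'; have -> : 0 = N by lia.
Qed.

Lemma det_polyS M : GL_in (@polyS k) M -> has_deg (\det M) 0.
Proof.
move=> MO; have [Mu _ _] := MO; have [h + E] := det_GL_inV MO.
rewrite E; have [N dN] := det_unit_has_deg Mu.
move=> /polyS_has_deg/(_ (has_degV dN)) N0; have := polyS_has_deg h dN.
by move=> N0'; have -> : 0 = N by lia.
Qed.

Definition lpoly_mx m n (P : 'M[{poly k}]_(m, n)) : 'M[F]_(m, n) :=
  map_mx (@laurent_poly k) P.

Lemma lpoly_mx_inj m n : injective (@lpoly_mx m n).
Proof.
move=> P Q /matrixP E; apply/matrixP => i j.
by apply: laurent_poly_inj; have := E i j; rewrite !mxE.
Qed.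

Lemma lpoly_mxM (P Q : 'M[{poly k}]_d) :
  lpoly_mx (P *m Q) = lpoly_mx P *m lpoly_mx Q.
Proof. exact: map_mxM. Qed.

(** As k[t] embeds in F, an inverse over F with polynomial entries is already an inverse over
    k[t]. *)
Lemma GL_in_polyS M :
  GL_in (@polyS k) M <-> exists2 P, P \in unitmx & M = lpoly_mx P.
Proof.
have ex (N : 'M[F]_d) : N \is a mxOver (@polyS k) -> exists P, N = lpoly_mx P.
  move=> /mxOverP NS.
  have h i j : exists p : {poly k}, N i j = laurent_poly p by exact/asboolP/NS.
  have [P PE] := boolp.choice (fun u : 'I_d * 'I_d => h u.1 u.2).
  exists (\matrix_(i, j) P (i, j)); apply/matrixP => i j; rewrite !mxE.
  exact: (PE (i, j)).
split.
  move=> [Mu /ex[P EP] /ex[Q EQ]]; exists P => //.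
  apply: (proj1 (@mulmx1_unit _ _ P Q _)); apply: lpoly_mx_inj.
  by rewrite lpoly_mxM -EP -EQ mulmxV// /lpoly_mx map_mx1.
move=> [P Pu ->]; have PV : lpoly_mx P *m lpoly_mx (invmx P) = 1%:M.
  by rewrite -lpoly_mxM mulmxV// /lpoly_mx map_mx1.
have [u1 u2] := mulmx1_unit PV.
have VE : invmx (lpoly_mx P) = lpoly_mx (invmx P).
  by rewrite -[LHS]mulmx1 -PV mulKmx.
by split; rewrite ?VE//; apply/mxOverP => i j; rewrite mxE;
  exact: laurent_poly_polyS.
Qed.

Definition tdiag (r : 'I_d -> int) : 'M[F]_d := diag_mx (\row_i tpow k (r i)).

Lemma mul_tdiagl r M i j : (tdiag r *m M) i j = tpow k (r i) * M i j.
Proof. by rewrite mul_diag_mx !mxE. Qed.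

Lemma mul_tdiagr r M i j : (M *m tdiag r) i j = tpow k (r j) * M i j.
Proof. by rewrite mul_mx_diag !mxE mulrC. Qed.

Lemma tdiagD r s : tdiag r *m tdiag s = tdiag (fun i => r i + s i).
Proof.
by apply/matrixP => i j; rewrite mul_tdiagl !mxE mulrnAr tpowD.
Qed.

Lemma tdiagN r : tdiag (fun i => - r i) *m tdiag r = 1%:M.
Proof.
rewrite tdiagD; apply/matrixP => i j; rewrite !mxE addNr tpow0.
by case: eqP.
Qed.

Lemma tdiag_unit r : tdiag r \in unitmx.
Proof. by have [] := mulmx1_unit (tdiagN r). Qed.

Lemma inv_tdiag r : invmx (tdiag r) = tdiag (fun i => - r i).
Proof. by rewrite -[LHS]mul1mx -(tdiagN r) mulmxK// tdiag_unit. Qed.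

Lemma det_tdiag r : \det (tdiag r) = tpow k (\sum_i r i).
Proof.
by rewrite det_diag -prod_tpow; apply: eq_bigr => i _; rewrite mxE.
Qed.

End LaurentMatrix.

(** * Birkhoff factorization by row reduction, and uniqueness of the exponents *)

Section Birkhoff.
Variables (k : fieldType) (d : nat).
Local Notation F := (laurent k).
Implicit Types (A B g : 'M[F]_d) (r s : 'I_d -> int).

Lemma det_neq0_perm (R : comNzRingType) n (M : 'M[R]_n) :
  \det M != 0 -> exists p : 'S_n, forall i, M i (p i) != 0.
Proof.
move=> detM; apply: contrapT => /forallNP H; move/eqP: detM; apply.
rewrite /determinant big1// => p _; have /existsNP[i /negP] := H p.
rewrite negbK => /eqP Mi.
by rewrite (bigD1 i)//= Mi mul0r mulr0.
Qed.

(* A nonzero term of the Leibniz formula for [\det A] gives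
   [a + r (p i) <= s i] for all [i]; comparing degrees of determinants forces
   equality. *)
Lemma tdiag_equiv_perm c a A B r s : has_deg c a ->
  GL_in (@polyS k) A -> GL_in (@ringO k) B ->
  c *: (A *m tdiag k r *m B) = tdiag k s ->
  exists p : 'S_d, forall i, s i = a + r (p i).
Proof.
move=> ca A_poly B_int E.
have [Au AS _] := A_poly; have [Bu _ BV] := B_int.
have detA : \det A != 0 by move: Au; rewrite unitmxE unitfE.
have [p pA] := det_neq0_perm detA; exists p.
(* Compare degrees at entry (i, p i) of c A t^r = t^s B^-1: on the left a + r (p i) plus the
   nonnegative degree of the entry of A, on the right at most s i. *)
have le_s i : 0 <= s i - (a + r (p i)).
  have [e Ae] := has_deg_ex (pA i).
  have e0 : 0 <= e by apply: polyS_has_deg Ae; exact: (mxOverP AS).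
  have := has_degM ca (has_degM (has_deg_tpow k (r (p i))) Ae).
  have -> : c * (tpow k (r (p i)) * A i (p i)) = tpow k (s i) * invmx B i (p i).
    rewrite -mul_tdiagl -E -scalemxAl -!mulmxA mulmxV// mulmx1.
    by rewrite mxE mul_tdiagr.
  move=> /has_deg_le/(_ (deg_leM (has_deg_tpow k (s i)).2 _))-/(_ 0).
  by rewrite addr0 => h; move: (h (ringOP _ (mxOverP BV _ _))); lia.
(* The determinants of A and B have degree 0, so only c^d and the two monomials count. The
   nonnegative differences above thus sum to 0. *)
have sum_s : \sum_i s i = a *+ d + \sum_i r i.
  have := congr1 determinant E; rewrite detZ !det_mulmx !det_tdiag => dE.
  have := has_degM (has_degX d ca) (has_degM (has_degM (det_polyS A_poly)
    (has_deg_tpow k (\sum_i r i))) (det_ringO B_int)).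
  by rewrite dE addr0 add0r; exact/has_deg_uniq/has_deg_tpow.
move=> i; apply/eqP; rewrite -subr_eq0; apply/eqP.
apply: (psumr_eq0P (P := xpredT) (F := fun i => s i - (a + r (p i)))) => //.
rewrite sumrB big_split/= sum_s sumr_const card_ord.
have <- : \sum_i r i = \sum_i r (p i) by exact: (reindex_inj (@perm_inj _ p)).
by rewrite subrr.
Qed.

(** The added matrix N lives in row [i0] and vanishes on the diagonal, so N^2 = 0 and 1 - N inverts
    1 + N. *)
Lemma row_add_unit (R : comUnitRingType) n (i0 : 'I_n) (u : 'I_n -> R) :
  u i0 = 0 -> 1%:M + \matrix_(i, j) (if i == i0 then u j else 0) \in unitmx.
Proof.
move=> u0; set N := \matrix_(i, j) _.
have NN : N *m N = 0.
  apply/matrixP => i j; rewrite !mxE big1// => l _; rewrite !mxE.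
  by have [->|] := eqVneq l i0; rewrite ?u0 ?if_same ?mul0r ?mulr0.
apply: (proj1 (@mulmx1_unit _ _ _ (1%:M - N) _)).
by rewrite mulmxDl mul1mx mulmxBr mulmx1 NN subr0 subrK.
Qed.

(** Dividing row i by t^(r i) makes the matrix integral and turns the determinant of the leading
    coefficients into the constant coefficient of its determinant. *)
Lemma GL_in_row_reduced g r : (forall i j, deg_le (g i j) (r i)) ->
  \det (\matrix_(i, j) g i j (r i)) != 0 ->
  GL_in (@ringO k) (tdiag k (fun i => - r i) *m g).
Proof.
move=> gr detL; apply: GL_in_ringO.
  apply/mxOverP => i j; apply/ringOP; rewrite mul_tdiagl -(addNr (r i)).
  by apply: deg_leM => //; have [] := has_deg_tpow k (- r i).
rewrite det_mulmx det_tdiag coefl_tpowM sub0r sumrN opprK.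
by have [_ ->] := coefl_det_top gr.
Qed.

(* Leading coefficients that are linearly dependent allow a row operation over
   k[t] that lowers one row degree, while the sum of the row degrees is bounded
   below by the degree of the determinant. *)
Lemma row_reduction m g r e : (\det g) e != 0 ->
  (forall i j, deg_le (g i j) (r i)) -> \sum_i r i < e + m%:Z ->
  exists A s, GL_in (@polyS k) A /\
    GL_in (@ringO k) (tdiag k (fun i => - s i) *m (A *m g)).
Proof.
elim: m g r => [|m IH] g r detg gr sum_r.
  (* With no fuel left, the row degrees sum to less than [e], which contradicts the nonzero
     coefficient of the determinant at [e]. *)
  have [dle _] := coefl_det_top gr.
  by move/eqP: detg; rewrite dle//; lia.
pose L := \matrix_(i, j) g i j (r i).
have [L0|L0] := eqVneq (\det L) 0; last first.
  exists 1%:M, r; rewrite mul1mx; split; last exact: GL_in_row_reduced.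
  by split; rewrite ?unitmx1 ?invmx1//; apply: mxOver_scalar;
    rewrite ?rpred0 ?rpred1.
have /det0P[c c0 cL] : \det L == 0 by rewrite L0.
have [i1 ci1] : exists i, c 0 i != 0.
  apply: contrapT => /forallNP c_0; move/eqP: c0; apply; apply/rowP => i.
  by rewrite mxE; apply/eqP; rewrite -[_ == _]negbK; exact/negP.
(* Among the rows in the support of the relation [c], the one of largest degree is modified; every
   multiplier t^(r i0 - r j) is then a polynomial. *)
pose i0 := [arg max_(i > i1 | c 0 i != 0) r i]%O.
have [ci0 maxr] : c 0 i0 != 0 /\ forall i, c 0 i != 0 -> r i <= r i0.
  by rewrite /i0; case: Order.TotalTheory.arg_maxP.
(* The value 0 at [i0] keeps [E] unipotent. Where r j exceeds r i0 the coefficient c 0 j is 0, so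
   the absolute value in the exponent is harmless. *)
pose u j : {poly k} :=
  if j == i0 then 0 else (c 0 j / c 0 i0) *: 'X^(absz (r i0 - r j)).
pose E := 1%:M + \matrix_(i, j) (if i == i0 then u j else 0).
have Eu : E \in unitmx by apply: row_add_unit; rewrite /u eqxx.
pose r' i := if i == i0 then r i - 1 else r i.
have Eg i : i != i0 -> forall j, (lpoly_mx E *m g) i j = g i j.
  move=> /negPf ii0 j; rewrite mxE (bigD1 i)//= big1 ?addr0.
    by rewrite !mxE eqxx ii0 addr0 rmorph1 mul1r.
  by move=> l li; rewrite !mxE ii0 addr0 eq_sym (negPf li) mulr0n rmorph0 mul0r.
have Eg0 j n : (lpoly_mx E *m g) i0 j n =
    \sum_l (c 0 l / c 0 i0) * g l j (n - (r i0 - r l)).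
  rewrite mxE coefl_sum; apply: eq_bigr => l _; rewrite !mxE eqxx /u.
  have [->|li0] := eqVneq l i0.
    by rewrite addr0 rmorph1 mul1r divff// mul1r subrr subr0.
  rewrite add0r -mul_polyC laurent_polyC_M laurent_polyXn -mulrA.
  have [cl0|cl0] := eqVneq (c 0 l) 0; first by rewrite cl0 !mul0r rmorph0 mul0r coefl0.
  rewrite coefl_polyC_M coefl_tpowM; congr (_ * g l j _).
  by have := maxr l cl0; lia.
have [A [s [AS AB]]] : exists A s, GL_in (@polyS k) A /\
    GL_in (@ringO k) (tdiag k (fun i => - s i) *m (A *m (lpoly_mx E *m g))).
  apply: (IH _ r').
  (* The determinant of [E] is a unit of k[t], hence a nonzero constant, and the coefficient at [e]
     stays nonzero. *)
  - rewrite det_mulmx det_map_mx.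
    have : \det E \is a GRing.unit by rewrite -unitmxE.
    rewrite poly_unitE => /andP[/size_poly1P[b b0 ->] _].
    by rewrite coefl_polyC_M mulf_neq0.
  - move=> i j; rewrite /r'; have [->|ii0] := eqVneq i i0; last by rewrite Eg.
    move=> n n_gt; rewrite Eg0.
    (* The coefficient of the new row at its old bound r i0 is (c L) / c i0, which vanishes by the
       choice of [c]. *)
    have [->|n_neq] := eqVneq n (r i0).
      transitivity ((c 0 i0)^-1 * (c *m L) 0 j).
        rewrite mxE mulr_sumr; apply: eq_bigr => l _; rewrite mxE mulrA [_ / _]mulrC.
        by congr (_ * g l j _); lia.
      by rewrite cL mxE mulr0.
    by rewrite big1// => l _; rewrite gr ?mulr0//; lia.
  - have : \sum_i r' i + 1 = \sum_i r i.
      rewrite (bigD1 i0)//= [RHS](bigD1 i0)//= /r' eqxx addrAC subrK.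
      by congr (_ + _); apply: eq_bigr => i /negPf ->.
    by lia.
exists (A *m lpoly_mx E), s; rewrite -[A *m _ *m g]mulmxA; split=> //.
by apply: GL_inM => //; apply/GL_in_polyS; exists E.
Qed.

End Birkhoff.

(** * Parametrization of the vertices of Y by partitions with last part 0 *)

Section VertexQuotient.
Variables (k : finFieldType) (d : nat).
Hypothesis d_gt0 : (0 < d)%N.
Local Notation F := (laurent k).
Local Notation G := (PGL F d).

Definition partitions : set (seq nat) :=
  [set s | size s = d /\ sorted geq s].

(** Sorting removes the permutations of the exponents; a last part 0 removes the scalars t^a, which
    are trivial in PGL_d. *)
Definition reduced_partitions : set (seq nat) :=
  [set s | partitions s /\ last 0%N s = 0%N].

Definition seq_tdiag (s : seq nat) : 'M[F]_d :=
  tdiag k (fun i : 'I_d => (nth 0%N s i)%:Z).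

Definition seq_vertex (s : seq nat) : G := pi_mx (seq_tdiag s).

Lemma eq_piY (x y : G) : (\pi_(Y k d) x = \pi_(Y k d) y)%qT <->
  exists a b : G, [/\ a \in Gamma k d, b \in maxK k d & y = (a * x * b)%g].
Proof.
by split=> [/eqmodP/asboolP|h]; last by apply/eqmodP/asboolP.
Qed.

Lemma Gamma_mx (M : 'M[F]_d) : GL_in (@polyS k) M -> pi_mx M \in Gamma k d.
Proof. by move=> MS; apply/PGL_overP; exists M. Qed.

Lemma maxK_mx (M : 'M[F]_d) : GL_in (@ringO k) M -> pi_mx M \in maxK k d.
Proof. by move=> MS; apply/PGL_overP; exists M. Qed.

(** Row reduction gives A g = t^r B with A over k[t] and B integral, so g lies in the double coset
    of t^r. This is the splitting of vector bundles on the projective line. *)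
Lemma birkhoff (x : G) :
  exists r : 'I_d -> int, (\pi_(Y k d) (pi_mx (tdiag k r)) = \pi_(Y k d) x)%qT.
Proof.
have [g gu ->] := pi_mx_surj x.
have [e [de _]] : exists e, has_deg (\det g) e.
  by apply: has_deg_ex; rewrite -unitfE -unitmxE.
have [N NP] := boolp.choice (fun u : 'I_d * 'I_d => coeflP (g u.1 u.2)).
(* A crude bound on the degrees in row i; the fuel of the reduction is its total excess over the
   degree [e] of the determinant. *)
pose r0 i : int := \sum_j `|N (i, j)|.
have gr i j : deg_le (g i j) (r0 i).
  apply: (@deg_leW _ _ (N (i, j))); last exact: (NP (i, j)).
  rewrite /r0 (bigD1 j)//=; apply: le_trans (ler_norm _) _.
  by rewrite lerDl sumr_ge0.
have [|A [r [AS AB]]] := row_reduction (m := (absz (\sum_i r0 i - e)%R).+1) de gr.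
  by lia.
have Au : A \in unitmx by have [] := AS.
exists r; apply/eq_piY; exists (pi_mx (invmx A)).
exists (pi_mx (tdiag k (fun i => - r i) *m (A *m g))).
split; [exact/Gamma_mx/GL_in_inv|exact: maxK_mx|].
rewrite -!pi_mxM ?unitmx_mul ?unitmx_inv ?Au ?tdiag_unit//=.
by rewrite !mulmxA -inv_tdiag mulmxK ?tdiag_unit// mulVmx// mul1mx.
Qed.

(** Permutation matrices lie in both subgroups, and the scalar t^a is trivial in PGL_d. *)
Lemma tdiag_perm_shift (r : 'I_d -> int) (a : int) (p : 'S_d) :
  (\pi_(Y k d) (pi_mx (tdiag k (fun i => (a + r (p i))%R))) =
   \pi_(Y k d) (pi_mx (tdiag k r)))%qT.
Proof.
apply/esym/eq_piY; exists (pi_mx (perm_mx p)), (pi_mx (perm_mx p^-1)).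
split; [exact/Gamma_mx/GL_in_perm|exact/maxK_mx/GL_in_perm|].
rewrite -!pi_mxM ?unitmx_mul ?unitmx_perm ?tdiag_unit//.
apply/esym/pi_mx_eq; rewrite ?unitmx_mul ?unitmx_perm ?tdiag_unit//.
exists (tpow k a); first exact: tpow_neq0.
rewrite -row_permE -col_permE; apply/matrixP => i j; rewrite !mxE.
by rewrite (inj_eq perm_inj) tpowD mulrnAr.
Qed.

Lemma partition_nth s i j : partitions s -> (i <= j < d)%N ->
  (nth 0 s j <= nth 0 s i)%N.
Proof.
move=> [sz srt] /andP[ij jd].
apply: (sorted_leq_nth (leT := geq)) => //.
- by move=> a b c ab bc; exact: leq_trans bc ab.
- by move=> a; exact: leqnn.
- by rewrite inE sz (leq_ltn_trans ij).
- by rewrite inE sz.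
Qed.

Lemma last_nth_partition s : partitions s -> last 0%N s = nth 0%N s d.-1.
Proof. by move=> [<- _]; rewrite nth_last. Qed.

(** The exponents of a Birkhoff factorization are sorted and their minimum is subtracted. *)
Lemma seq_vertex_surj (x : G) : exists2 s, reduced_partitions s &
  (\pi_(Y k d) (seq_vertex s) = \pi_(Y k d) x)%qT.
Proof.
have [r <-] := birkhoff x.
pose L := sort (>=%O) (codom r); pose a := last 0 L.
have szL : size L = d by rewrite size_sort size_codom card_ord.
have [p pE] : exists p : 'S_d, forall i : 'I_d, nth 0 L i = r (p i).
  have /tuple_permP[p E] : perm_eq L [tuple r i | i < d].
    by rewrite perm_sort.
  by exists p => i; rewrite E -tnth_nth !tnth_mktuple.
have Lsrt : sorted (>=%O) L by apply: sort_sorted => u v; exact: le_total.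
have Lge i : (i < d)%N -> a <= nth 0 L i.
  move=> id; rewrite /a -nth_last szL.
  rewrite -[_ <= _]/((>=%O) (nth 0 L i) (nth 0 L d.-1)).
  apply: (@sorted_leq_nth _ (>=%O) _ _ 0 L Lsrt i d.-1) => //;
    rewrite ?inE ?szL ?prednK//; last by lia.
    by move=> u v w uv vw; exact: le_trans vw uv.
  by move=> u; exact: lexx.
pose s := [seq absz (u - a)%R | u <- L].
have sE i : (i < d)%N -> (nth 0%N s i)%:Z = nth 0 L i - a.
  by move=> id; rewrite (nth_map 0) ?szL// gez0_abs// subr_ge0 Lge.
have sP : partitions s.
  split; first by rewrite size_map.
  rewrite sorted_map; apply: (sub_in_sorted (P := mem L) _ _ Lsrt).
    move=> u v /(nthP 0)[i + <-] /(nthP 0)[j + <-]; rewrite szL => id jd /= h.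
    by rewrite -lez_nat !gez0_abs ?subr_ge0 ?Lge// lerD2r.
  exact/allP.
exists s.
  split=> //; rewrite last_nth_partition//.
  apply/eqP; rewrite -eqz_nat sE ?prednK// /a -[last _ _]nth_last szL.
  by rewrite subrr.
rewrite -(tdiag_perm_shift r (- a) p); congr (\pi_(Y k d) (pi_mx (tdiag k _)))%qT.
by apply: boolp.funext => i; rewrite sE// pE addrC.
Qed.

(* Sorting and [last = 0] rigidify the permutation and the scalar [a]. *)
Lemma reduced_partition_rigid s u (a : int) (p : 'S_d) :
  reduced_partitions s -> reduced_partitions u ->
  (forall i : 'I_d, (nth 0%N u i)%:Z = a + (nth 0%N s (p i))%:Z) ->
  a = 0 /\ s = u.
Proof.
move=> [sP s0] [uP u0] E.
have ld : (d.-1 < d)%N by rewrite prednK.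
pose l := Ordinal ld.
have nl w : partitions w -> last 0%N w = 0%N -> nth 0%N w l = 0%N.
  by move=> wP w0; rewrite /= -last_nth_partition.
(* At the last index [l] the equation gives a <= 0, and at the preimage of [l] under p it gives a >=
   0. *)
have a0 : a = 0.
  have := E l; rewrite nl//; have := E (p^-1 l)%g; rewrite permKV nl//.
  by lia.
split=> //; have [szs srts] := sP; have [szu srtu] := uP.
apply: (sorted_eq (leT := geq)) => //.
- by move=> x y z xy yz; exact: leq_trans yz xy.
- by move=> x y /andP[xy yx]; apply/eqP; rewrite eqn_leq; apply/andP.
rewrite perm_sym; apply/(perm_iotaP 0%N).
exists [seq val (p i) | i <- enum 'I_d].
  rewrite szs -val_enum_ord (map_comp val p); apply: perm_map; apply: uniq_perm.
  - by rewrite map_inj_uniq ?enum_uniq//; exact: perm_inj.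
  - exact: enum_uniq.
  - move=> i; rewrite mem_enum; apply/mapP; exists (p^-1 i)%g; rewrite ?mem_enum//.
    by rewrite permKV.
apply: (@eq_from_nth _ 0%N);  first by rewrite 2!size_map size_enum_ord.
move=> i; rewrite szu => id; have := E (Ordinal id); rewrite a0 add0r => -[->].
rewrite -map_comp (nth_map (Ordinal id)) ?size_enum_ord//=.
by rewrite (nth_ord_enum _ (Ordinal id)).
Qed.

Lemma seq_vertex_inj s u : reduced_partitions s -> reduced_partitions u ->
  (\pi_(Y k d) (seq_vertex s) = \pi_(Y k d) (seq_vertex u))%qT -> s = u.
Proof.
move=> sP uP /eq_piY[_ [_ [/PGL_overP[A AS ->] /PGL_overP[B BS ->]]]].
have [Au _ _] := AS; have [Bu _ _] := BS.
rewrite /seq_vertex -!pi_mxM ?unitmx_mul ?Au ?tdiag_unit//.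
move=> /esym/pi_mx_eq[]; rewrite ?unitmx_mul ?Au ?tdiag_unit// => c c0 E.
have [a ca] := has_deg_ex c0.
have [p pE] := tdiag_equiv_perm ca AS BS (esym E).
by have [] := reduced_partition_rigid sP uP pE.
Qed.

Lemma seq_vertex_bij : set_bij reduced_partitions [set: Y k d]
  (fun s => \pi_(Y k d) (seq_vertex s))%qT.
Proof.
split=> //.
- by move=> s u; rewrite !inE => sP uP; exact: seq_vertex_inj.
- elim/quotW=> x _; have [s sP E] := seq_vertex_surj x.
  by exists s.
Qed.

End VertexQuotient.

(** * Cardinals of products, of GL_m(k), and of spaces of polynomial matrices *)

Section Cardinal.

Lemma has_card_inj (T U : Type) (A : set T) (B : set U) (f : T -> U) n :
  {in A &, injective f} -> f @` A = B -> (A #= `I_n)%card -> (B #= `I_n)%card.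
Proof. by move=> f_inj <-; rewrite (card_eql (inj_card_eq f_inj)). Qed.

Lemma has_card_finType (T : finType) : ([set: T] #= `I_#|T|)%card.
Proof.
rewrite (card_eqr card_II) card_eq_sym.
have <- : @enum_rank T @` setT = setT.
  by apply/seteqP; split=> // i _; exists (enum_val i) => //; exact: enum_valK.
by apply: inj_card_eq => x y _ _; exact: enum_rank_inj.
Qed.

(** Pairs are numbered by f x n + g y and recovered by Euclidean division by n. *)
Lemma has_cardX (T U : Type) (A : set T) (B : set U) m n :
  (A #= `I_m)%card -> (B #= `I_n)%card -> (A `*` B #= `I_(m * n))%card.
Proof.
move=> /card_set_bijP[f [fA f_inj f_surj]] /card_set_bijP[g [gB g_inj g_surj]].
rewrite card_eq_sym.
have <- : (fun u => f u.1 * n + g u.2)%N @` (A `*` B) = `I_(m * n).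
  apply/seteqP; split=> [_ [[x y] [/= Ax By] <-]|i /= imn].
    have := fA x Ax; have /= := gB y By; rewrite /= => gn fm.
    apply: (@leq_trans ((f x).+1 * n)); first by rewrite mulSn addnC ltn_add2r.
    by rewrite leq_mul2r fm orbT.
  have n0 : (0 < n)%N by case: (n) imn => //; rewrite muln0.
  have [x Ax fx] := f_surj (i %/ n)%N (etrans (ltn_divLR _ _ n0) imn).
  have [y By gy] := g_surj (i %% n)%N (ltn_pmod i n0).
  by exists (x, y) => //=; rewrite fx gy -divn_eq.
apply: inj_card_eq => -[x y] [x' y']; rewrite !inE => -[/= Ax By] [/= Ax' By'] E.
have gn := gB y By; have gn' := gB y' By'; rewrite /= in gn gn'.
have n0 : (0 < n)%N by exact: leq_ltn_trans gn.
have Ef : f x = f x'.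
  by have := congr1 (divn^~ n) E; rewrite /= !divnMDl// !divn_small// !addn0.
have Eg : g y = g y'.
  by have := congr1 (modn^~ n) E; rewrite /= !modnMDl !modn_small.
by congr (_, _); [apply: f_inj|apply: g_inj]; rewrite ?inE.
Qed.

Lemma has_card_uniq (T : Type) (A : set T) m n :
  (A #= `I_m)%card -> (A #= `I_n)%card -> m = n.
Proof. by move=> Am An; apply/card_eq_II; rewrite -(card_eql Am). Qed.

Lemma has_card_counting (R : realType) (T : choiceType) (A : set T) n :
  (A #= `I_n)%card -> counting A = n%:R%:E :> \bar R.
Proof.
move=> An; rewrite /counting asboolT ?(card_fset_set An)//.
by apply/finite_setP; exists n.
Qed.

Lemma has_card_GL (k : finFieldType) m :
  ([set D : 'M[k]_m.+1 | D \in unitmx] #= `I_#|'GL_m.+1[k]%g|)%card.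
Proof.
apply: (has_card_inj (A := [set: {'GL_m.+1[k]}]) (f := fun x => GLval x)).
- by move=> x y _ _; exact: val_inj.
- apply/seteqP; split=> [_ [x _ <-]|D Du]; first exact: (valP x).
  by exists (FinRing.Unit Du).
- by have := has_card_finType {'GL_m.+1[k]}; rewrite -cardsT.
Qed.

(** Row i contributes [e i] free coefficients in each of the m columns; the index type [I] lists
    them. *)
Lemma has_card_poly_mx (k : finFieldType) a m (e : 'I_a -> nat) :
  ([set B : 'M[{poly k}]_(a, m) | forall i j, (size (B i j) <= e i)%N] #=
   `I_(#|k| ^ ((\sum_i e i) * m)))%card.
Proof.
pose I : finType := ({i : 'I_a & 'I_(e i)} * 'I_m)%type.
pose f (u : {ffun I -> k}) : 'M[{poly k}]_(a, m) := \matrix_(i, j)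
  \poly_(l < e i) (if @insub nat (fun l => l < e i)%N 'I_(e i) l is Some l'
                   then u (Tagged (fun i => 'I_(e i)) l', j) else 0).
have fE u i j (l : 'I_(e i)) : (f u i j)`_l = u (Tagged (fun i => 'I_(e i)) l, j).
  by rewrite mxE coef_poly ltn_ord valK.
apply: (has_card_inj (A := [set: {ffun I -> k}]) (f := f)).
- move=> u v _ _ E; apply/ffunP => -[[i l] j].
  by rewrite -[LHS]fE -[RHS]fE E.
- apply/seteqP; split=> [_ [u _ <-] i j|B Bsz]; first by rewrite mxE size_poly.
  exists [ffun x : I => (B (tag x.1) x.2)`_(tagged x.1)] => //.
  apply/matrixP => i j; apply/polyP => l.
  have [lt_l|ge_l] := ltnP l (e i).
    by rewrite -[l]/(val (Ordinal lt_l)) fE ffunE.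
  rewrite mxE coef_poly ltnNge ge_l nth_default//.
  exact: leq_trans (Bsz i j) ge_l.
- have := has_card_finType {ffun I -> k}.
  by rewrite card_ffun card_prod card_ord card_tagged sumnE big_map big_enum/=
    (eq_bigr e)// => i _; rewrite card_ord.
Qed.

End Cardinal.

(** * Orders of the automorphism groups, one block at a time *)

Section Automorphisms.
Variable k : finFieldType.

(* The automorphism group of the vector bundle with splitting type [s]. *)
Definition auts d (s : seq nat) : set 'M[{poly k}]_d :=
  [set P : 'M[{poly k}]_d | P \in unitmx /\ forall (i j : 'I_d) l,
    (nth 0 s i < nth 0 s j + l)%N -> (P i j)`_l = 0].
Arguments auts : clear implicits.

Lemma auts_shift d s c : size s = d -> auts d (map (addn c) s) = auts d s.
Proof.
move=> sz; apply/seteqP; split=> P [Pu PE]; split=> // i j l ijl;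
  apply: PE; move: ijl; rewrite !(nth_map 0%N) ?sz//; lia.
Qed.

Lemma has_card_auts0 s : (auts 0 s #= `I_1)%card.
Proof.
suff -> : auts 0 s = [set 1%:M] by exact: card_set1.
apply/seteqP; split=> [P _|_ ->]; first by apply/matrixP => -[].
by split=> [|[]]; rewrite ?unitmx1.
Qed.

(** The degree bounds force a block upper triangular shape: the lower left block vanishes, the lower
    right one is an invertible constant matrix, the upper left one is an automorphism for s, and row
    i of the upper right one is free of degree at most s_i + 1, that is with s_i + 2
    coefficients. *)
Lemma has_card_auts a m s N : size s = a -> (auts a s #= `I_N)%card ->
  (auts (a + m.+1) (map S s ++ nseq m.+1 0%N) #=
   `I_(N * (#|'GL_m.+1[k]%g| * #|k| ^ ((sumn s + a.*2) * m.+1))))%card.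
Proof.
move=> sz sN; set u := _ ++ _.
have uL (i : 'I_a) : nth 0%N u (lshift m.+1 i) = (nth 0%N s i).+1.
  by rewrite nth_cat size_map sz /= ltn_ord (nth_map 0%N) ?sz.
have uR (i : 'I_m.+1) : nth 0%N u (rshift a i) = 0%N.
  by rewrite nth_cat size_map sz ltnNge leq_addr nth_nseq if_same.
pose e (i : 'I_a) := (nth 0%N s i).+2.
have sum_e : (\sum_i e i = sumn s + a.*2)%N.
  rewrite (eq_bigr (fun i : 'I_a => nth 0 s i + 2)%N) => [|i _]; last by rewrite addn2.
  by rewrite big_split/= sum_nat_const card_ord sumnE (big_nth 0%N) big_mkord sz muln2.
have := has_cardX sN (has_cardX (has_card_GL k m) (has_card_poly_mx k m.+1 e)).
rewrite sum_e; apply: (has_card_inj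
  (f := fun X : ('M[{poly k}]_a * ('M[k]_m.+1 * 'M[{poly k}]_(a, m.+1)))%type =>
          block_mx X.1 X.2.2 0 (map_mx polyC X.2.1))).
- move=> [A [D B]] [A' [D' B']] _ _ /= /eq_block_mx[-> -> _ DD].
  suff -> : D = D' by [].
  apply/matrixP => i j; have /matrixP/(_ i j) := DD.
  by rewrite !mxE => /polyC_inj.
have detD (D : 'M[k]_m.+1) :
    (\det (map_mx polyC D) \is a GRing.unit) = (D \in unitmx).
  rewrite det_map_mx poly_unitE.
  rewrite size_polyC coefC eqxx unitmxE !unitfE.
  by case: (\det D == 0).
apply/seteqP; split=> [_ [[A [D B]] [[/= Au AE] [/= Du Bsz]] <-]|P [Pu PE]].
  split; first by rewrite unitmxE det_ublock unitrM detD Du -unitmxE Au.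
  move=> i j l; case: (split_ordP i) => {}i ->; case: (split_ordP j) => {}j ->.
  - by rewrite !uL block_mxEul => h; apply: AE; lia.
  - rewrite uL uR block_mxEur => h; rewrite nth_default//.
    by apply: leq_trans (Bsz i j) _; rewrite /e; lia.
  - by rewrite block_mxEdl mxE coef0.
  - by rewrite !uR block_mxEdr mxE coefC; case: l.
pose D := map_mx (coefp 0) (drsubmx P).
have EP : P = block_mx (ulsubmx P) (ursubmx P) 0 (map_mx polyC D).
  rewrite -[LHS]submxK; congr block_mx; apply/matrixP => i j; rewrite !mxE.
    by apply/polyP => l; rewrite coef0 PE// uL uR.
  apply/polyP => l; rewrite coefC; case: eqP => [->//|l0].
  by apply: PE; rewrite !uR; case: l l0.
have /andP[Au Du] : (\det (ulsubmx P) \is a GRing.unit) && (D \in unitmx).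
  by rewrite -detD -unitrM -(det_ublock _ (ursubmx P)) -EP -unitmxE.
exists (ulsubmx P, (D, ursubmx P)); last by rewrite -EP.
split; [|split=> //=].
  by split=> [|i j l ij]; rewrite ?unitmxE// !mxE; apply: PE; rewrite !uL.
move=> i j; apply/leq_sizeP => l el; rewrite !mxE; apply: PE.
by rewrite uL uR.
Qed.


End Automorphisms.
Arguments auts : clear implicits.

(** * Stabilizers of the diagonal vertices *)

Section Stabilizer.
Variables (k : finFieldType) (d : nat).
Hypothesis d_gt0 : (0 < d)%N.
Local Notation F := (laurent k).
Local Notation G := (PGL F d).

(** Summing over i cancels the permuted sum and leaves d a = 0. *)
Lemma perm_shift0 (r : 'I_d -> int) a (p : 'S_d) :
  (forall i, r i = a + r (p i)) -> a = 0.
Proof.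
move=> E; have : \sum_i r i = a *+ d + \sum_i r i.
  rewrite [LHS](eq_bigr _ (fun i _ => E i)) big_split/= sumr_const card_ord.
  by congr (_ + _); apply/esym; exact: (reindex_inj (@perm_inj _ p)).
by nia.
Qed.

Lemma lpoly_mx_GL (P : 'M[{poly k}]_d) : P \in unitmx -> GL_in (@polyS k) (lpoly_mx P).
Proof. by move=> Pu; apply/GL_in_polyS; exists P. Qed.

Lemma lpoly_mx_unit (P : 'M[{poly k}]_d) : P \in unitmx -> lpoly_mx P \in unitmx.
Proof. by move=> /lpoly_mx_GL[]. Qed.

(** A in GL_d(k[t]) fixes the vertex when some multiple of t^-s A t^s is integral with integral
    inverse. Once the scalar is known to have degree 0, this says deg A_ij <= s_i - s_j. Conversely
    such a conjugate is integral with determinant of degree 0. *)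
Lemma seq_vertex_stabilizer s :
  stabilizer (seq_vertex k d s) = (fun P => pi_mx (lpoly_mx P)) @` auts k d s.
Proof.
have tu := tdiag_unit k (fun i : 'I_d => (nth 0%N s i)%:Z).
have conjE (A : 'M[F]_d) : A \in unitmx ->
    ((seq_vertex k d s)^-1 * pi_mx A * seq_vertex k d s)%g =
    pi_mx (tdiag k (fun i : 'I_d => - (nth 0%N s i)%:Z) *m A *m seq_tdiag k d s).
  move=> Au; rewrite /seq_vertex -pi_mxV// inv_tdiag.
  by rewrite !pi_mxM ?unitmx_mul ?Au ?tdiag_unit.
apply/seteqP; split=> [x [/PGL_overP[A AS ->]]|_ [P [Pu PE] <-]].
  have [Au _ _] := AS; rewrite conjE// => /PGL_overP[B BS].
  have [Bu BO _] := BS.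
  move=> /pi_mx_eq[]; rewrite ?unitmx_mul ?Au ?tdiag_unit// => c c0 EB.
  have [a ca] := has_deg_ex c0.
  (* In this form uniqueness of the exponents applies with t^s on both sides, and forces [c] to have
     degree 0. *)
  have E : c *: (A *m seq_tdiag k d s *m invmx B) = seq_tdiag k d s.
    rewrite -[RHS](mulmxK Bu) EB -scalemxAr -!mulmxA -inv_tdiag mulKVmx//.
    by rewrite -scalemxAl -!mulmxA.
  have [p pE] := tdiag_equiv_perm ca AS (GL_in_inv BS) E.
  have a0 := perm_shift0 pE; rewrite a0 in ca.
  move/GL_in_polyS: AS => [P Pu AP]; exists P; rewrite ?AP//; split=> // i j l ijl.
  rewrite -[LHS]/(laurent_poly (P i j) l%:Z).
  have -> : laurent_poly (P i j) = A i j by rewrite AP mxE.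
  have [->|Aij0] := eqVneq (A i j) 0; first by rewrite coefl0.
  have [e Ae] := has_deg_ex Aij0.
  have := has_degM ca (has_degM (has_deg_tpow k (nth 0%N s j)%:Z)
    (has_degM (has_deg_tpow k (- (nth 0%N s i)%:Z)) Ae)).
  have -> : c * (tpow k (nth 0%N s j)%:Z *
      (tpow k (- (nth 0%N s i)%:Z) * A i j)) = B i j.
    by rewrite EB mxE mul_tdiagr mul_tdiagl.
  move=> /has_deg_le/(_ (ringOP _ (mxOverP BO i j))) e_le.
  by have [_ ->] := Ae => //; lia.
split; first exact/Gamma_mx/lpoly_mx_GL.
rewrite conjE; last exact: lpoly_mx_unit.
apply/maxK_mx/GL_in_ringO.
  apply/mxOverP => i j; apply/ringOP => -[l|l] l0 //.
  rewrite mul_tdiagr coefl_tpowM mul_tdiagl coefl_tpowM mxE laurent_polyE.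
  by case E : (_ - _) => [n|//]; apply: PE; lia.
rewrite !det_mulmx !det_tdiag mulrAC -tpowD sumrN addNr tpow0 mul1r.
by have [] := det_polyS (lpoly_mx_GL Pu).
Qed.

(* The fibres of [auts -> stabilizer] are the orbits of the scalars k^*. *)
Lemma has_card_stabilizer s N : (auts k d s #= `I_N)%card ->
  exists2 m, (stabilizer (seq_vertex k d s) #= `I_m)%card & N = (m * #|k|.-1)%N.
Proof.
move=> sN; have fin_stab : finite_set (stabilizer (seq_vertex k d s)).
  by rewrite seq_vertex_stabilizer; apply: finite_image; apply/finite_setP; exists N.
have /finite_setP[m mE] := fin_stab; exists m => //.
(* [h] chooses a polynomial lift of each stabilizer element; its values elsewhere are irrelevant. *)
have lift_ex (x : G) : exists P, x \in stabilizer (seq_vertex k d s) ->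
    auts k d s P /\ pi_mx (lpoly_mx P) = x.
  have [|xS] := boolP (x \in stabilizer (seq_vertex k d s)); last by exists 0.
  by rewrite inE seq_vertex_stabilizer => -[P PS <-]; exists P.
have [h hE] := boolp.choice lift_ex.
have kE : ([set c : k | c != 0] #= `I_#|k|.-1)%card.
  pose T : finType := {c : k | c != 0}.
  have -> : #|k|.-1 = #|T|.
    by rewrite card_sig -(cardC1 (0 : k)); apply: eq_card => c; rewrite !inE.
  apply: (has_card_inj (f := val)) (has_card_finType T) => [x y _ _|].
    exact: val_inj.
  by apply/seteqP; split=> [_ [x _ <-]|c c0]; [exact: (valP x)|exists (Sub c c0)].
apply: has_card_uniq sN _.
have hS x : stabilizer (seq_vertex k d s) x ->
    [/\ auts k d s (h x), h x \in unitmx & pi_mx (lpoly_mx (h x)) = x].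
  by move=> xS; have [|[hu hP] hx] := hE x; rewrite ?inE.
have lZ (c : k) (P : 'M[{poly k}]_d) :
    lpoly_mx (c%:P *: P) = laurent_poly c%:P *: lpoly_mx P.
  by rewrite /lpoly_mx map_mxZ.
have c_neq0 (c : k) : c != 0 -> laurent_poly c%:P != 0.
  move=> c0; rewrite -(rmorph0 (@laurent_poly k)).
  by rewrite (inj_eq (@laurent_poly_inj k)) polyC_eq0.
have ZU (c : k) (P : 'M[{poly k}]_d) : c != 0 -> P \in unitmx -> c%:P *: P \in unitmx.
  move=> c0; rewrite !unitmxE detZ unitrM => ->; rewrite andbT unitrX//.
  by rewrite poly_unitE size_polyC c0 coefC unitfE.
have piZ (c : k) (P : 'M[{poly k}]_d) : c != 0 -> P \in unitmx ->
    pi_mx (lpoly_mx (c%:P *: P)) = pi_mx (lpoly_mx P).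
  move=> c0 Pu; apply/esym/pi_mx_eq; rewrite ?lpoly_mx_unit ?ZU//.
  by exists (laurent_poly c%:P); rewrite ?c_neq0.
apply: (has_card_inj (f := fun u : G * k => u.2%:P *: h u.1)) (has_cardX mE kE).
  move=> [x c] [y b]; rewrite !inE => -[/= xS c0] [/= yS b0] E.
  have [_ hxu xE] := hS x xS; have [_ hyu yE] := hS y yS.
  have xy : x = y by rewrite -xE -yE -(piZ c)// E piZ.
  congr (_, _) => //; move: E; rewrite -xy => /(congr1 (mulmx^~ (invmx (h x)))).
  rewrite /= -!scalemxAl mulmxV// => /matrixP/(_ (Ordinal d_gt0) (Ordinal d_gt0)).
  by rewrite !mxE eqxx !mulr1 => /polyC_inj.
apply/seteqP; split=> [_ [[x c] [/= xS c0] <-]|P [Pu PE]].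
  have [[_ hP] hxu _] := hS x xS; split=> [|i j l ijl]; first exact: ZU.
  by rewrite mxE coefCM hP ?mulr0.
set x := pi_mx (lpoly_mx P).
have xS : stabilizer (seq_vertex k d s) x.
  by rewrite seq_vertex_stabilizer; exists P.
have [[hu hP] _ /pi_mx_eq[]] := hS x xS; rewrite ?lpoly_mx_unit// => e e0 eE.
pose o := Ordinal d_gt0.
(* Both the ratio [e] of two lifts and its inverse are entries of polynomial matrices, so [e] is a
   unit of k[t], a nonzero constant. *)
have e1 : e = laurent_poly ((P *m invmx (h x)) o o).
  have : lpoly_mx (P *m invmx (h x)) = e *: lpoly_mx 1%:M.
    by rewrite lpoly_mxM eE -scalemxAl -lpoly_mxM mulmxV.
  by move=> /matrixP/(_ o o); rewrite !mxE eqxx rmorph1 mulr1 => <-.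
have e2 : e^-1 = laurent_poly ((h x *m invmx P) o o).
  have : e *: lpoly_mx (h x *m invmx P) = lpoly_mx 1%:M.
    by rewrite lpoly_mxM scalemxAl -eE -lpoly_mxM mulmxV.
  move=> /matrixP/(_ o o); rewrite !mxE eqxx rmorph1 => ee.
  by rewrite -[LHS]mulr1 -ee mulKf.
have : (P *m invmx (h x)) o o \is a GRing.unit.
  apply/unitrPr; exists ((h x *m invmx P) o o); apply: (@laurent_poly_inj k).
  by rewrite rmorphM/= -e1 -e2 mulfV// rmorph1.
rewrite poly_unitE => /andP[/size_poly1P[c c0 cE] _].
exists (x, c) => //=; apply: lpoly_mx_inj.
by rewrite lZ -cE -e1 -eE.
Qed.

End Stabilizer.

(** * A q-binomial identity *)

Section QIdentity.
Variables (R : realFieldType) (q : R).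
Hypothesis q_gt1 : 1 < q.

Definition qfact n : R := \prod_(1 <= i < n.+1) (q ^+ i - 1).
(** The product starts at i = 1: without the factor 1 - z it stays nonzero at z = 1. *)
Definition qpoch n (z : R) : R := \prod_(1 <= i < n) (q ^+ i - z).
(** The order of GL_m over a field with q elements. *)
Definition glcard m : R := q ^+ 'C(m, 2) * qfact m.
(* The Gaussian binomial coefficient in base 1/q, times q^-C(m,2). *)
Definition qcoef d m : R :=
  qfact d / (qfact m * qfact (d - m)) / q ^+ (m * (d - m) + 'C(m, 2)).

Let q_gt0 : 0 < q. Proof. exact: lt_trans q_gt1. Qed.
Let q_neq0 : q != 0. Proof. by rewrite gt_eqF. Qed.

Lemma qfactS n : qfact n.+1 = qfact n * (q ^+ n.+1 - 1).
Proof. by rewrite /qfact big_nat_recr. Qed.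

Lemma qpochS n z : qpoch n.+2 z = qpoch n.+1 z * (q ^+ n.+1 - z).
Proof. by rewrite /qpoch big_nat_recr. Qed.

Lemma qfact_gt0 n : 0 < qfact n.
Proof.
elim: n => [|n IH]; first by rewrite /qfact big_nil.
by rewrite qfactS mulr_gt0// subr_gt0 exprn_egt1.
Qed.

Lemma qpoch_gt0 n z : z <= 1 -> 0 < qpoch n z.
Proof.
move=> z1; rewrite /qpoch big_seq; apply: prodr_gt0 => i.
rewrite mem_index_iota => /andP[i0 _].
by rewrite subr_gt0 (le_lt_trans z1)// exprn_egt1// -lt0n.
Qed.

(** Multiplying q^i - z / q^(m+1) by q^(m+1) gives q^(i+m+1) - z, which supplies the factors of
    index m + 1 to n + m. *)
Lemma qpoch_shift n m z :
  (\prod_(i < n) (q ^+ i - z / q ^+ m.+1)) * q ^+ (n * m.+1) * qpoch m.+1 z =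
  qpoch (n + m.+1) z.
Proof.
elim: n => [|n IH]; first by rewrite big_ord0 mul0n expr0 !mul1r.
rewrite addSn addnS qpochS -addnS -IH big_ord_recr/= mulSn !exprD.
have : q ^+ m.+1 != 0 by rewrite expf_neq0.
by move: (q ^+ m.+1) => x x0; field.
Qed.

Lemma qpoch_recl n z : \prod_(i < n.+1) (q ^+ i - z) = (1 - z) * qpoch n.+1 z.
Proof.
by rewrite -(big_mkord xpredT (fun i => q ^+ i - z)) big_ltn// expr0.
Qed.

(** The q-Pascal rule in this normalization. With d = m + n + 1 all powers of q become monomials in
    four of them, and a rational identity remains. *)
Lemma qcoef_pascal d m : (m < d)%N ->
  qcoef d.+1 m.+1 = qcoef d m / q ^+ m + qcoef d m.+1 / q ^+ m.+1.
Proof.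
move=> md; have [n ->] : exists n, d = (m + n).+1.
  by exists (d - m.+1)%N; lia.
rewrite /qcoef subSS.
have -> : ((m + n).+1 - m = n.+1)%N by lia.
have -> : ((m + n).+1 - m.+1 = n)%N by lia.
rewrite !qfactS binS bin1.
have x1 : q ^+ m.+1 - 1 != 0 by rewrite gt_eqF// subr_gt0 exprn_egt1.
have y1 : q ^+ n.+1 - 1 != 0 by rewrite gt_eqF// subr_gt0 exprn_egt1.
have Pm := lt0r_neq0 (qfact_gt0 m); have Pn := lt0r_neq0 (qfact_gt0 n).
have qE i : q ^+ i != 0 by rewrite expf_neq0.
have e1 : q ^+ (m.+1 * n.+1 + ('C(m, 2) + m)) =
    q ^+ (m * n.+1 + 'C(m, 2)) * q ^+ m * q ^+ n.+1.
  by rewrite -!exprD; congr (_ ^+ _); lia.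
have e2 : q ^+ (m.+1 * n + ('C(m, 2) + m)) =
    q ^+ (m * n.+1 + 'C(m, 2)) * q ^+ m * q ^+ n.+1 / q ^+ m.+1.
  by apply/(canRL (mulfK (qE _))); rewrite -!exprD; congr (_ ^+ _); lia.
have e3 : q ^+ (m + n).+2 = q ^+ m.+1 * q ^+ n.+1.
  by rewrite -exprD; congr (_ ^+ _); lia.
rewrite e1 e2 e3; have := qE (m * n.+1 + 'C(m, 2))%N; have := qE m.
have := qE m.+1; have := qE n.+1.
move: (q ^+ (m * n.+1 + _)) (q ^+ m) (q ^+ m.+1) (q ^+ n.+1) x1 y1.
move=> a b x y x1 y1 y0 x0 b0 a0.
by field; rewrite y1 x1 Pm Pn y0 x0 b0 a0.
Qed.

Lemma qcoef0 d : qcoef d 0 = 1.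
Proof.
rewrite /qcoef subn0 mul0n expr0 divr1 {2}/qfact big_nil mul1r divff//.
exact/lt0r_neq0/qfact_gt0.
Qed.

Lemma qcoef_diag d : qcoef d d = (q ^+ 'C(d, 2))^-1.
Proof.
rewrite /qcoef subnn muln0 add0n {3}/qfact big_nil mulr1 divff ?mul1r//.
exact/lt0r_neq0/qfact_gt0.
Qed.

(** Induction on d, splitting each coefficient by the Pascal rule. In the first half the term m = 0
    is z^d, and the others, reindexed, carry the factor (q^(m+1) - z) / q^(m+1); the second half
    carries z / q^(m+1). These add up to 1 and leave the sum for d. *)
Lemma qcoef_sum d z :
  \sum_(m < d) qcoef d m.+1 * z ^+ (d - m.+1) * qpoch m.+1 z =
  \sum_(i < d) z ^+ i.
Proof.
elim: d => [|d IH]; first by rewrite !big_ord0.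
have qE i : q ^+ i != 0 by rewrite expf_neq0.
transitivity (\sum_(m < d.+1) qcoef d m / q ^+ m * z ^+ (d - m) * qpoch m.+1 z +
  \sum_(m < d) qcoef d m.+1 / q ^+ m.+1 * z ^+ (d - m) * qpoch m.+1 z).
  rewrite big_ord_recr [in RHS]big_ord_recr/= addrAC -big_split/=; congr (_ + _).
    apply: eq_bigr => m _; rewrite qcoef_pascal// subSS.
    by rewrite !mulrDl.
  rewrite !qcoef_diag !subnn binS bin1 exprD invfM; ring.
rewrite big_ord_recl/= qcoef0 subn0 {1}/qpoch big_geq// [RHS]big_ord_recr/= -IH.
rewrite expr0 invr1 !mulr1 mul1r -addrA addrC; congr (_ + _).
rewrite -big_split/=; apply: eq_bigr => m _.
have -> : (d - m = (d - m.+1).+1)%N by have := ltn_ord m; lia.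
rewrite /bump/= add1n qpochS [z ^+ (_ - _).+1]exprS.
have := qE m.+1; move: (q ^+ m.+1) => x x0.
by field.
Qed.

End QIdentity.

(** * Decompositions of partitions *)

Section PartitionSums.

Lemma partitions0 : partitions 0 = [set [::]].
Proof.
by apply/seteqP; split=> [s [/size0nil]|_ ->].
Qed.

(* Adding a lowest block: [m.+1] parts 0 below the parts of [s], all raised by
   one. *)
Definition add_block (u : nat * seq nat) := map S u.2 ++ nseq u.1.+1 0%N.

Lemma sumn_add_block m s : sumn (add_block (m, s)) = (sumn s + size s)%N.
Proof.
rewrite /add_block sumn_cat sumn_nseq mul0n addn0.
by elim: s => //= x s ->; lia.
Qed.

Lemma count_add_block u : count_mem 0%N (add_block u) = u.1.+1.
Proof.
rewrite /add_block count_cat count_map (eq_count (a2 := pred0))//.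
by rewrite count_pred0 count_nseq mul1n.
Qed.

Lemma geq_transitive : transitive geq.
Proof. by move=> x y z xy yz; exact: leq_trans yz xy. Qed.

Lemma geq_antisym : antisymmetric geq.
Proof. by move=> x y /andP[xy yx]; apply/eqP; rewrite eqn_leq; apply/andP. Qed.

Lemma pairwise_geq_nseq n x : pairwise geq (nseq n x).
Proof. by elim: n => //= n ->; rewrite all_nseq /= leqnn orbT. Qed.

(** The inverse counts the zeros, m + 1 of them, and lowers the positive parts by one. *)
Lemma add_block_bij d : (0 < d)%N ->
  set_bij (`I_d `*`` (fun m => partitions (d - m.+1))) (reduced_partitions d)
    add_block.
Proof.
move=> d_gt0; split.
- move=> [m s] [/= md [sz srt]]; rewrite /add_block [(m, s).1]/= [(m, s).2]/=.
  split; last first.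
    by rewrite last_cat /=; elim: (m).
  split; first by rewrite size_cat size_map size_nseq sz; lia.
  move: srt; rewrite !(sorted_pairwise geq_transitive) => srt.
  rewrite pairwise_cat pairwise_map srt pairwise_geq_nseq !andbT.
  by apply/allrelP => x y _; rewrite inE mem_nseq => /orP[/eqP ->|/andP[_ /eqP ->]].
- move=> [m s] [m' s']; rewrite !inE => -[/= md [sz _]] [/= md' [sz' _]] E.
  have mm : m = m'.
    by have := congr1 (count_mem 0%N) E; rewrite !count_add_block => -[].
  subst m'; congr (_, _); move: E => /eqP.
  rewrite /add_block eqseq_cat ?size_map ?sz ?sz'// => /andP[/eqP E _].
  by apply: inj_map E; exact: succn_inj.
- move=> s [[sz srt] s0].
  pose t := [seq x <- s | x != 0%N].
  have zE : [seq x <- s | predC (predC1 0%N) x] = nseq (count_mem 0%N s) 0%N.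
    have /all_pred1P -> : all (pred1 0%N) [seq x <- s | predC (predC1 0%N) x].
      rewrite (eq_filter (a2 := pred1 0%N)); first exact: filter_all.
      by move=> x; rewrite /= negbK.
    by rewrite size_filter; congr nseq; apply: eq_count => x; rewrite /= negbK.
  have sE : s = t ++ nseq (count_mem 0%N s) 0%N.
    apply: (sorted_eq geq_transitive geq_antisym srt).
      rewrite (sorted_pairwise geq_transitive) pairwise_cat.
      rewrite -(sorted_pairwise geq_transitive t) sorted_filter//; last exact: geq_transitive.
      rewrite pairwise_geq_nseq !andbT.
      by apply/allrelP => x y _; rewrite mem_nseq => /andP[_ /eqP ->].
    by rewrite perm_sym -zE; exact/permPl/perm_filterC.
  have cnt : (0 < count_mem 0%N s)%N.
    rewrite -has_count has_pred1.
    case: (s) sz s0 => [|x s' _ /= <-]; last exact: mem_last.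
    by move=> d0; rewrite -d0 in d_gt0.
  have tS : map S (map predn t) = t.
    rewrite -map_comp -[RHS]map_id; apply/eq_in_map => x.
    by rewrite mem_filter => /andP[x0 _] /=; rewrite prednK// lt0n.
  exists ((count_mem 0%N s).-1, map predn t); last first.
    by rewrite /add_block tS prednK.
  have szt : size t = (d - count_mem 0%N s)%N.
    by have := congr1 size sE; rewrite size_cat size_nseq sz => ->; rewrite addnK.
  split=> /=; first by rewrite prednK// -sz count_size.
  split; first by rewrite size_map szt prednK.
  rewrite sorted_map; apply: (sub_sorted (e := geq)).
    by move=> x y /=; rewrite /geq; lia.
  by apply: sorted_filter => //; exact: geq_transitive.
Qed.

(** The shift is recovered as the last, hence smallest, part. *)
Lemma shift_bij d : (0 < d)%N ->
  set_bij ([set: nat] `*`` (fun=> reduced_partitions d)) (partitions d)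
    (fun u => map (addn u.1) u.2).
Proof.
move=> d_gt0; have last_shift j s :
    reduced_partitions d s -> last 0%N (map (addn j) s) = j.
  move=> [[sz _]]; case: s sz => [d0|x s _ /= s0]; first by rewrite -d0 in d_gt0.
  by rewrite last_map s0 addn0.
split.
- move=> [j s] [_ [[sz srt] _]]; split; first by rewrite size_map.
  rewrite sorted_map; apply: sub_sorted srt => x y /=.
  by rewrite /geq/= leq_add2l.
- move=> [j s] [j' s']; rewrite !inE => -[/= _ sP] [/= _ sP'] E.
  have jj : j = j' by rewrite -(last_shift j s sP) E last_shift.
  by congr (_, _) => //; move: E; rewrite jj; apply: inj_map; exact: addnI.
- move=> s sP; have [sz srt] := sP; pose j := last 0%N s.
  have j_le x : x \in s -> (j <= x)%N.
    move=> /(nthP 0%N)[i]; rewrite sz => id <-.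
    by rewrite /j (last_nth_partition sP); apply: (partition_nth sP); lia.
  exists (j, map (subn^~ j) s).
    split=> //; split.
      split; first by rewrite size_map.
      rewrite sorted_map; apply: sub_sorted srt => x y /=.
      by rewrite /geq; lia.
    rewrite /j; case: (s) => //= x s'; rewrite (last_map (subn^~ _)).
    by rewrite subnn.
  rewrite /= -map_comp -[RHS]map_id; apply/eq_in_map => x xs /=.
  by rewrite subnKC ?j_le.
Qed.

End PartitionSums.

(** * Generating functions of a weight compatible with shifts and blocks *)

Section PartitionWeight.
Variables (R : realType) (q : R) (w : nat -> seq nat -> R).
Hypothesis q_gt1 : 1 < q.
Hypothesis w_ge0 : forall d s, 0 <= w d s.
Hypothesis w0 : w 0 [::] = 1.
Hypothesis w_shift : forall d s c, size s = d -> w d (map (addn c) s) = w d s.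
Hypothesis w_block : forall a m s, partitions a s ->
  w (a + m.+1) (add_block (m, s)) =
    w a s / (glcard q m.+1 * q ^+ ((sumn s + a.*2) * m.+1)).
Local Open Scope ereal_scope.

(** The closed form of the generating function over all partitions with d parts; its factor i = 0
    gives the pole at z = 1. *)
Definition partition_sum d (z : R) : R :=
  ((qfact q d * \prod_(i < d) (q ^+ i - z))^-1)%R.

Lemma esum_geometric (a x : R) : (0 <= a)%R -> (0 < x < 1)%R ->
  \esum_(j in [set: nat]) (a * x ^+ j)%:E = (a / (1 - x))%:E.
Proof.
move=> a0 /andP[x0 x1]; rewrite -nneseries_esumT; last first.
  by move=> n; rewrite lee_fin mulr_ge0// exprn_ge0// ltW.
apply: cvg_lim => //.
have := @cvg_geometric_series R a x; rewrite gtr0_norm// => /(_ x1) h.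
rewrite (_ : (fun n => _) = EFin \o series (geometric a x)); last first.
  by apply: boolp.funext => n; rewrite /= sumEFin.
exact: cvg_comp h _.
Qed.

(** Splitting off the zeros, the factor q^(-(m+1)|s|) of the block rule replaces z by z / q^(m+1) in
    the sum over the remaining parts. This is below 1 even for z = 1, so the induction hypothesis
    applies; [qcoef_sum] then adds up the blocks. *)
Lemma esum_reduced_partitions d (c z : R) :
  (forall n z c, (n < d)%N -> (0 <= c)%R -> (0 < z < 1)%R ->
    \esum_(s in partitions n) (c * w n s * z ^+ sumn s)%:E =
      (c * partition_sum n z)%:E) ->
  (0 < d)%N -> (0 <= c)%R -> (0 < z <= 1)%R ->
  \esum_(s in reduced_partitions d) (c * w d s * z ^+ sumn s)%:E =
    (c * (\sum_(i < d) z ^+ i) / (qfact q d * qpoch q d z))%:E.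
Proof.
move=> IH d0 c0 /andP[z0 z1].
have q0 : (0 < q)%R by apply: lt_trans q_gt1.
rewrite (@reindex_esum _ _ _ _ _ _ _ (add_block_bij d0)).
rewrite -(esum_esum (a := fun m s =>
  (c * w d (add_block (m, s)) * z ^+ sumn (add_block (m, s)))%:E)); last first.
  by move=> m s _ _; rewrite lee_fin !mulr_ge0// exprn_ge0// ltW.
have inner m : (m < d)%N ->
  \esum_(s in partitions (d - m.+1))
    (c * w d (add_block (m, s)) * z ^+ sumn (add_block (m, s)))%:E =
  (c * (qcoef q d m.+1 * z ^+ (d - m.+1) * qpoch q m.+1 z) /
    (qfact q d * qpoch q d z))%:E.
  move=> md; set n := (d - m.+1)%N.
  have dE : d = (n + m.+1)%N by rewrite /n; lia.
  have qE i : (q ^+ i != 0)%R by rewrite expf_neq0// gt_eqF.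
  have zq : (0 < z / q ^+ m.+1 < 1)%R.
    rewrite divr_gt0 ?exprn_gt0//= ltr_pdivrMr ?exprn_gt0// mul1r.
    by rewrite (le_lt_trans z1)// exprn_egt1.
  have gl0 : (0 < glcard q m.+1)%R by rewrite mulr_gt0 ?exprn_gt0 ?qfact_gt0.
  (* All factors independent of s: z^n appears because each of the n remaining parts was raised by
     one. *)
  pose c' := (c * z ^+ n / (glcard q m.+1 * q ^+ (n.*2 * m.+1)))%R.
  have c'0 : (0 <= c')%R.
    by apply: divr_ge0; apply: mulr_ge0 => //; rewrite ?exprn_ge0//; apply: ltW.
  rewrite (eq_esum (b := fun s => (c' * w n s * (z / q ^+ m.+1) ^+ sumn s)%:E)).
    rewrite IH//; last by rewrite /n; lia.
    congr (_%:E); rewrite /partition_sum /c' /glcard /qcoef -/n dE -qpoch_shift//.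
    have -> : (n.*2 * m.+1 = n * m.+1 + n * m.+1)%N by lia.
    move: 'C(m.+1, 2) => C; rewrite -dE [(m.+1 * n)%N]mulnC !exprD.
    have Pd0 := lt0r_neq0 (qfact_gt0 q_gt1 d).
    have Pm0 := lt0r_neq0 (qfact_gt0 q_gt1 m.+1).
    have Pn0 := lt0r_neq0 (qfact_gt0 q_gt1 n).
    have Qm0 := lt0r_neq0 (qpoch_gt0 q_gt1 m.+1 z1).
    have X0 : (\prod_(i < n) (q ^+ i - z / q ^+ m.+1) != 0)%R.
      have := qpoch_gt0 q_gt1 d z1; rewrite dE -qpoch_shift// => /lt0r_neq0.
      by rewrite !mulf_eq0 !negb_or => /andP[/andP[]].
    have := qE C; have := qE (n * m.+1)%N.
    move: (\prod_(i < n) _)%R X0 (q ^+ (n * _))%R (q ^+ C)%R => X X0 x y x0 y0.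
    by field; rewrite Pd0 Pm0 Pn0 Qm0 X0 x0 y0.
  move=> s sP; congr (_%:E); have [sz _] := sP.
  rewrite sumn_add_block sz [in LHS]dE w_block// /c' exprMn exprVn -exprM.
  rewrite [(m.+1 * _)%N]mulnC mulnDl !exprD.
  have := gt_eqF gl0; move: (glcard _ _) => g /negbT g0.
  have := qE (sumn s * m.+1)%N; have := qE (n.*2 * m.+1)%N.
  move: (q ^+ (sumn s * _))%R (q ^+ (n.*2 * _))%R => x y y0 x0.
  by field; rewrite x0 y0 g0.
rewrite esum_fset//; last first.
  move=> m _; apply: esum_ge0 => s _.
  by rewrite lee_fin !mulr_ge0// exprn_ge0// ltW.
rewrite -fsbig_ord (eq_bigr (fun m : 'I_d =>
  (c * (qcoef q d m.+1 * z ^+ (d - m.+1) * qpoch q m.+1 z) /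
    (qfact q d * qpoch q d z))%:E)) => [|m _]; last exact: inner.
by rewrite sumEFin -mulr_suml -mulr_sumr qcoef_sum.
Qed.

(** A shift by j multiplies the term by z^(d j), so the sum over reduced partitions is multiplied by
    1 / (1 - z^d), whose factor 1 + z + ... + z^(d-1) cancels. *)
Lemma esum_partitions d (c z : R) : (0 <= c)%R -> (0 < z < 1)%R ->
  \esum_(s in partitions d) (c * w d s * z ^+ sumn s)%:E =
    (c * partition_sum d z)%:E.
Proof.
elim/ltn_ind: d c z => -[_|d IH] c z c0 /andP[z0 z1].
  rewrite partitions0 esum_set1 ?w0 /partition_sum/qfact; last first.
    by rewrite lee_fin !mulr_ge0// exprn_ge0// ltW.
  by rewrite big_nil big_ord0 expr0 !mulr1 invr1 mulr1.
rewrite (@reindex_esum _ _ _ _ _ _ _ (shift_bij (ltn0Sn d))).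
rewrite -(esum_esum (a := fun j s =>
  (c * w d.+1 (map (addn j) s) * z ^+ sumn (map (addn j) s))%:E)); last first.
  by move=> m s _ _; rewrite lee_fin !mulr_ge0// exprn_ge0// ltW.
have z10 : (0 < z <= 1)%R by rewrite z0 ltW.
have Q0 := qpoch_gt0 q_gt1 d.+1 (ltW z1).
have P0 := qfact_gt0 q_gt1 d.+1.
set S := (\sum_(i < d.+1) z ^+ i)%R.
have SE : (1 - z ^+ d.+1 = (1 - z) * S)%R.
  by rewrite -opprB subrX1 -mulNr opprB.
have zX : (0 < z ^+ d.+1 < 1)%R.
  by rewrite exprn_gt0//= exprn_ilt1// ltW.
have S_ge0 : (0 <= S)%R by apply: sumr_ge0 => i _; rewrite exprn_ge0// ltW.
rewrite (eq_esum (b := fun j : nat => (c * S /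
   (qfact q d.+1 * qpoch q d.+1 z) * (z ^+ d.+1) ^+ j)%:E)).
  rewrite esum_geometric//; last first.
    by rewrite divr_ge0 ?mulr_ge0// ltW.
  congr (_%:E); rewrite /partition_sum qpoch_recl SE.
  have S0 : S != 0%R.
    have /andP[_] := zX; rewrite -subr_gt0 SE.
    by apply: contraTneq => ->; rewrite mulr0 ltxx.
  have z1' : (1 - z != 0)%R by rewrite subr_eq0 gt_eqF.
  by field; rewrite S0 z1' !lt0r_neq0.
move=> j _; have c'0 : (0 <= c * (z ^+ d.+1) ^+ j)%R.
  by rewrite mulr_ge0 ?exprn_ge0// ltW.
transitivity (\esum_(s in reduced_partitions d.+1)
  (c * (z ^+ d.+1) ^+ j * w d.+1 s * z ^+ sumn s)%:E).
  apply: eq_esum => s [[sz _] _]; rewrite w_shift//; congr (_%:E).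
  have -> : sumn (map (addn j) s) = (d.+1 * j + sumn s)%N.
    by rewrite -sz; elim: (s) => [|x s' IHs] /=; lia.
  by rewrite exprD exprM; ring.
rewrite esum_reduced_partitions//; last by move=> n y b nd b0 y0; exact: IH.
by congr (_%:E); rewrite -/S; ring.
Qed.

(** The reduced sum is available at z = 1 itself, where 1 + z + ... + z^(d-1) equals d; no limit is
    taken. *)
Lemma esum_reduced_partitions1 d (c : R) : (0 < d)%N -> (0 <= c)%R ->
  \esum_(s in reduced_partitions d) (c * w d s)%:E =
    (c * d%:R / (qfact q d * qpoch q d 1))%:E.
Proof.
move=> d0 c0.
have := @esum_reduced_partitions d c 1 (fun n z c _ => @esum_partitions n c z) d0 c0.
rewrite ltr01 lexx => /(_ isT).
rewrite (eq_bigr (fun=> 1%R)) => [|i _]; last by rewrite expr1n.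
rewrite sumr_const card_ord => <-.
by apply: eq_esum => s _; rewrite expr1n mulr1.
Qed.

End PartitionWeight.

(** * The vertex volume as a weighted sum over partitions *)

Section VertexVolume.
Variables (R : realType) (k : finFieldType).
Local Notation q := (#|k|%:R : R).

Definition autw d s : R := (#|` fset_set (auts k d s)|%:R)^-1.

Lemma card_field_gt1 : 1 < q.
Proof. by rewrite ltr1n; exact: card_finNzRing_gt1. Qed.

Lemma glcardE m : glcard q m.+1 = #|'GL_m.+1[k]%g|%:R.
Proof.
rewrite card_GL// natrM natrX natr_prod; congr (_ * _).
rewrite /qfact !big_seq; apply: eq_bigr => i _.
by rewrite natrB ?natrX// expn_gt0 (leq_trans _ (card_finNzRing_gt1 k)).
Qed.

Lemma partition_split d s : (0 < d)%N -> partitions d s ->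
  exists j m t, [/\ (m < d)%N, partitions (d - m.+1) t &
    s = map (addn j) (add_block (m, t))].
Proof.
move=> d0 sP.
have [_ _ /(_ s sP)[[j u] [/= _ uP] <-]] := shift_bij d0.
have [_ _ /(_ u uP)[[m t] [/= md tP] <-]] := add_block_bij d0.
by exists j, m, t.
Qed.

(** Induction on the number of parts: shift the last part to 0 and remove the lowest block. *)
Lemma finite_auts d s : partitions d s -> finite_set (auts k d s).
Proof.
elim/ltn_ind: d s => -[_|d IH] s sP.
  by apply/finite_setP; exists 1%N; exact: has_card_auts0.
have [j [m [t [md tP ->]]]] := partition_split (ltn0Sn d) sP.
have [szt _] := tP; have dE : d.+1 = (d.+1 - m.+1 + m.+1)%N by lia.
rewrite auts_shift; last first.
  by rewrite /add_block size_cat size_map size_nseq szt/= -dE.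
have /finite_setP[N tN] : finite_set (auts k (d.+1 - m.+1) t) by apply: IH => //; lia.
have := has_card_auts m szt tN; rewrite -dE => h.
by apply/finite_setP; eexists; exact: h.
Qed.

Lemma has_card_auts_fset d s : partitions d s ->
  (auts k d s #= `I_#|` fset_set (auts k d s)|)%card.
Proof. by move=> /finite_auts/finite_setP[N sN]; rewrite (card_fset_set sN). Qed.

Lemma auts1 d s : auts k d s 1%:M.
Proof.
split=> [|i j l]; first exact: unitmx1.
rewrite mxE; have [->|_] := eqVneq i j; last by rewrite coef0.
by rewrite coef1; case: l => //; rewrite addn0 ltnn.
Qed.

Lemma auts_card_gt0 d s : partitions d s -> (0 < #|` fset_set (auts k d s)|)%N.
Proof.
move=> sP; rewrite lt0n cardfs_eq0; apply/eqP => E.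
have : 1%:M \in fset_set (auts k d s).
  by rewrite in_fset_set ?inE; [exact: auts1|exact: finite_auts].
by rewrite E in_fset0.
Qed.

Lemma autw_block a m s : partitions a s ->
  autw (a + m.+1) (add_block (m, s)) =
    autw a s / (glcard q m.+1 * q ^+ ((sumn s + a.*2) * m.+1)).
Proof.
move=> sP; have [sz _] := sP; rewrite /autw.
rewrite (card_fset_set (has_card_auts m sz (has_card_auts_fset sP))).
by rewrite !natrM natrX -glcardE !invfM.
Qed.

Variable d : nat.
Hypothesis d_gt0 : (0 < d)%N.
Local Open Scope ereal_scope.

(** Passing from automorphisms to their classes in PGL_d divides the order by q - 1. *)
Lemma stabilizer_card s : partitions d s ->
  exists m, [/\ (0 < m)%N, (stabilizer (seq_vertex k d s) #= `I_m)%card &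
    (counting (stabilizer (seq_vertex k d s)))^-1 = ((q - 1) * autw d s)%:E].
Proof.
move=> sP.
have [m mE NE] := has_card_stabilizer d_gt0 (has_card_auts_fset sP).
have := auts_card_gt0 sP; rewrite NE muln_gt0 => /andP[m0 k0]; exists m; split=> //.
rewrite (has_card_counting R mE) inver pnatr_eq0 gtn_eqF//; congr (_%:E).
have -> : (q - 1 = #|k|.-1%:R)%R.
  by rewrite -subn1 natrB// (leq_trans _ (card_finNzRing_gt1 k)).
by rewrite /autw NE natrM invfM mulrCA divff ?mulr1// pnatr_eq0 -lt0n.
Qed.

Lemma vertex_volumeE :
  vertex_volume k d R = ((q - 1) * d%:R / (qfact q d * qpoch q d 1))%:E.
Proof.
rewrite /vertex_volume (@reindex_esum _ _ _ _ _ _ _ (seq_vertex_bij k d_gt0)).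
rewrite -(@esum_reduced_partitions1 R q autw card_field_gt1)//.
- apply: eq_esum => s [sP _]; rewrite vertex_mass_pi.
  by have [m [_ _ ->]] := stabilizer_card sP.
- by move=> n s; rewrite invr_ge0.
- by rewrite /autw (card_fset_set (has_card_auts0 _ _)) invr1.
- by move=> n s c sz; rewrite /autw auts_shift.
- exact: autw_block.
- by rewrite subr_ge0 ltW// card_field_gt1.
Qed.

End VertexVolume.

(** * Fibers of the quotient measure over the vertices *)

Section QuotientMeasure.
Local Open Scope quotient_scope.
Variables (R : realType) (k : finFieldType) (d : nat).
Local Notation F := (laurent k).
Local Notation G := (PGL F d).

(** For h close to g, the matrix g^-1 h is congruent to 1 modulo 1/t, hence lies in
    GL_d(k[[1/t]]). *)
Lemma right_invariant_open (U : set G) :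
  (forall x b, U x -> b \in maxK k d -> U (x * b)%g) -> PGL_open U.
Proof.
move=> UK g Ug; have gu := glP g.
have [N NP] := boolp.choice (fun u : 'I_d * 'I_d => coeflP (invmx g u.1 u.2)).
pose M : int := \sum_u `|N u|.
have M_ge0 : 0 <= M by exact: sumr_ge0.
have gM i j : deg_le (invmx g i j) M.
  apply: (@deg_leW _ _ (N (i, j))); last exact: (NP (i, j)).
  rewrite /M (bigD1 (i, j))//=; apply: le_trans (ler_norm _) _.
  by rewrite lerDl sumr_ge0.
(* The entries of g^-1 have degree at most M, so precision M + 1 leaves degree at most -1 in g^-1 (h
   - g). *)
exists (absz M).+1 => h hg.
pose B := invmx (glval g) *m glval h.
pose D : 'M[F]_d := glval h - glval g.
have BE : B = 1%:M + invmx (glval g) *m D.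
  by rewrite mulmxBr mulVmx// addrC subrK.
have eB i j : deg_le ((invmx (glval g) *m D) i j) (- 1).
  rewrite mxE; apply: deg_le_sum => l _.
  apply: (deg_leW _ (deg_leM (M := - (absz M).+1%:Z) (gM i l) _)) => [|n n_gt].
    by move: M_ge0; clearbody M; lia.
  by rewrite !mxE; exact: hg n_gt.
have BO i j : deg_le (B i j) 0.
  rewrite BE mxE; apply: deg_leD; last by apply: deg_leW (eB i j).
  by rewrite mxE; case: eqP => _; [exact: deg_le1|exact: deg_le0].
have BK : GL_in (@ringO k) B.
  apply: GL_in_ringO; first by apply/mxOverP => i j; exact/ringOP.
  have [_] := coefl_det_top (r := fun=> 0) BO; rewrite big1// => ->.
  suff -> : \matrix_(i, j) B i j 0 = 1%:M by rewrite det1 oner_neq0.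
  apply/matrixP => i j; rewrite mxE BE mxE coeflD eB// addr0 !mxE.
  by case: (i == j); rewrite ?coefl1 ?coefl0.
have -> : \pi_G h = (\pi_G g * pi_mx B)%g.
  by rewrite -!pi_mx_glval -pi_mxM// ?unitmx_mul ?unitmx_inv ?gu ?glP// mulKVmx.
by apply: UK => //; exact: maxK_mx.
Qed.

Lemma right_invariant_measurable (U : set G) :
  (forall x b, U x -> b \in maxK k d -> U (x * b)%g) -> measurable U.
Proof. by move=> UK; apply: sub_sigma_algebra; exact: right_invariant_open. Qed.

Lemma to_Y_measurable (S : set (Y k d)) : measurable (@to_Y k d @^-1` S).
Proof.
apply: right_invariant_measurable => x b /=; rewrite !to_Y_pi => Sx bK.
suff <- : \pi_(Y k d) x = \pi_(Y k d) (x * b)%g by [].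
by apply/eq_piY; exists 1%g, b; rewrite gpred1 mul1g.
Qed.

Local Open Scope ereal_scope.

Lemma esum_card (T : choiceType) (A : set T) n : (A #= `I_n)%card ->
  \esum_(i in A) 1 = n%:R%:E :> \bar R.
Proof.
move=> /card_set_bijP[f fb].
rewrite -(@reindex_esum R _ _ _ _ _ (fun=> 1) fb) esum_fset//.
by rewrite -fsbig_ord sumEFin sumr_const card_ord.
Qed.

Variables (mu : {measure set G -> \bar R}).
Variable (mubar : {measure set (Gamma_G k d) -> \bar R}).
Hypothesis mu_Haar : is_Haar mu.
Hypothesis mubar_quot : is_quotient_measure mu mubar.

(** Unfold the indicator of g K, of Haar measure 1: the sum over Gamma is m on the fiber above the
    vertex of g and 0 elsewhere. *)
Lemma quotient_fiber (g : G) m : (stabilizer g #= `I_m)%card ->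
  1 = m%:R%:E * mubar (@to_Y k d @^-1` [set \pi_(Y k d) g]).
Proof.
move=> gm; have [mu_inv mu_K] := mu_Haar.
pose A := [set (g * x)%g | x in [set` maxK k d]].
have AE x : A x <-> (g^-1 * x)%g \in maxK k d.
  split=> [[y /= yK <-]|xK]; first by rewrite mulKg.
  by exists (g^-1 * x)%g => //=; rewrite mulgA mulgV mul1g.
have mK : measurable [set` maxK k d].
  by apply: right_invariant_measurable => x b /= xK bK; rewrite gpredM.
have mA : measurable A.
  apply: right_invariant_measurable => x b /AE xK bK; apply/AE.
  by rewrite mulgA gpredM.
set B := @to_Y k d @^-1` _.
have mB : measurable B by exact: to_Y_measurable.
have := mubar_quot (f := fun x => (\1_A x)%:E).
rewrite integral_indic// setIT mu_inv// mu_K => ->; last 2 first.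
- by apply/measurable_EFinP; exact: measurable_indic.
- by move=> x; rewrite lee_fin.
rewrite -[in RHS](setIT B) -integral_indic// -ge0_integralZl_EFin//; last first.
  by apply/measurable_EFinP; exact: measurable_indic.
apply: eq_integral => x _; rewrite -EFinM.
pose C := [set c | A (c * generic_quotient.repr x)%g].
transitivity (\esum_(c in [set` Gamma k d] `&` C) (1 : \bar R)).
  rewrite esum_mkcondr; apply: eq_esum => c _.
  have -> : (c \in C) = (c * generic_quotient.repr x \in A)%g.
    by apply/idP/idP; rewrite !inE.
  by rewrite indicE; case: (_ \in A).
have [xB|xB] := pselect (B x).
  rewrite indicE mem_set// mulr1.
  have [a [b [aG bK E]]] : exists a b : G,
      [/\ a \in Gamma k d, b \in maxK k d & generic_quotient.repr x = (a * g * b)%g].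
    by apply/eq_piY; rewrite -[RHS]/(to_Y x).
  rewrite -(esum_card gm).
  (* With representative a g b, the element c a^-1 sends it to c g b, which lies in g K exactly when
     g^-1 c g lies in K. *)
  rewrite (@reindex_esum R _ _ (stabilizer g) _ (fun c => c * a^-1)%g)//.
  split.
  - move=> c [cG cK]; split=> /=; first by rewrite gpredM// gpredV.
    by apply/AE; rewrite E !mulgA mulgVK gpredM// !mulgA.
  - by move=> c c' _ _; exact: mulIg.
  - move=> c [/= cG /AE cK]; exists (c * a)%g; last by rewrite mulgK.
    split; first by rewrite gpredM.
    move: cK; rewrite E !mulgA => cK.
    by rewrite -(mulgK b (_ * g)%g) gpredM ?gpredV.
rewrite indicE memNset// mulr0 esum1// => c [/= cG /AE cK]; case: xB.
rewrite /B /= -[LHS]/(\pi_(Y k d) (generic_quotient.repr x)); apply/esym/eq_piY.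
exists c^-1%g, (g^-1 * (c * generic_quotient.repr x))%g; rewrite gpredV; split=> //.
by rewrite !mulgA mulgK mulVg mul1g.
Qed.

Hypothesis d_gt0 : (0 < d)%N.

Lemma quotient_fiber_mass s : reduced_partitions d s ->
  mubar (@to_Y k d @^-1` [set \pi_(Y k d) (seq_vertex k d s)]) =
  vertex_mass R (\pi_(Y k d) (seq_vertex k d s)).
Proof.
move=> [sP _]; have [m [m0 mE _]] := stabilizer_card R k d_gt0 sP.
rewrite vertex_mass_pi (has_card_counting R mE).
have m_neq0 : m%:R%:E != 0 :> \bar R by rewrite eqe pnatr_eq0 -lt0n.
by rewrite -[LHS]mul1e -(mulVe m_neq0)// -muleA -(quotient_fiber mE) mule1.
Qed.

(** Countable additivity over the fibers; they are numbered through the codes of partitions, since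
    the union must be indexed by integers. *)
Lemma quotient_mass : mubar setT = vertex_volume k d R.
Proof.
pose e s : Y k d := \pi_(Y k d) (seq_vertex k d s).
have e_bij : set_bij _ _ e := seq_vertex_bij k d_gt0.
have [_ e_inj e_surj] := e_bij.
pose D : set nat := choice.pickle @` reduced_partitions d.
pose B n := @to_Y k d @^-1`
  (e @` [set s | reduced_partitions d s /\ choice.pickle s = n]).
have BE s : reduced_partitions d s -> B (choice.pickle s) = @to_Y k d @^-1` [set e s].
  move=> sP; rewrite /B; congr (_ @^-1` _); apply/seteqP; split=> y.
    by move=> [u [_ /(pcan_inj choice.pickleK) ->] <-].
  by move=> ->; exists s.
have -> : setT = \bigcup_(n in D) B n.
  apply/seteqP; split=> // x _; have [s sP sx] := e_surj (to_Y x) I.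
  by exists (choice.pickle s); [exists s|rewrite BE].
rewrite measure_bigcup.
- rewrite nneseries_esum//.
  have -> : [set n | n \in D] = D by apply/seteqP; split=> n; rewrite /= inE.
  have pickle_bij : set_bij (reduced_partitions d) D (@choice.pickle (seq nat)).
    split=> //; first by move=> s sP; exists s.
    by move=> s u _ _; exact: (pcan_inj choice.pickleK).
  rewrite (@reindex_esum _ _ _ _ _ _ _ pickle_bij).
  rewrite /vertex_volume (@reindex_esum _ _ _ _ _ _ _ e_bij).
  by apply: eq_esum => s sP; rewrite BE// quotient_fiber_mass.
- by move=> n _; exact: to_Y_measurable.
- move=> m n _ _ [x [[s [sP <-] sx] [u [uP <-] ux]]].
  by congr choice.pickle; apply: e_inj; rewrite ?inE// sx ux.
Qed.

End QuotientMeasure.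

(** * Total mass of the vertex quotient *)

Theorem theorem1p1 (R : realType) (k : finFieldType) (q d : nat)
    (card_k : #|k| = q) (d_ge2 : (2 <= d)%N) :
  (forall (mu : {measure set (PGL (laurent k) d) -> \bar R})
          (mubar : {measure set (Gamma_G k d) -> \bar R}),
     is_Haar mu -> is_quotient_measure mu mubar ->
     pushforward mubar (@to_Y k d) [set: Y k d] = vertex_volume k d R) /\
  vertex_volume k d R =
    (d%:R / ((\prod_(1 <= m < d.+1) (q%:R ^+ m - 1)) *
             (\prod_(2 <= m < d) (q%:R ^+ m - 1))))%:E.
Proof.
have d_gt0 : (0 < d)%N by exact: ltnW.
split=> [mu mubar mu_Haar mubar_quot|].
  exact: quotient_mass mu_Haar mubar_quot d_gt0.
rewrite vertex_volumeE// card_k; congr (_%:E).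
have q1 : q%:R - 1 != 0 :> R by rewrite subr_eq0 -card_k gt_eqF// card_field_gt1.
(* As d is at least 2, [qpoch] at 1 contains the factor q - 1, which cancels the one coming from the
   scalars. *)
rewrite /qpoch big_ltn// expr1 -/(qfact q%:R d) [qfact _ _ * _]mulrCA invfM.
by rewrite mulrACA divff// mul1r.
Qed.
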